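(* Let $G=(X,Y;E)$ be a bipartite graph with bipartition classes $X,Y$, where $|X|=m$ and $|Y|=n$. Suppose that $n\geq m\geq 2k+2$ for some nonnegative integer $k$. If $e(G)\geq n(m-k-1)+k+2$, then $G$ contains cycles of every even length $\ell$ with $4\leq \ell\leq 2m-2k$.
   Context: All graphs are finite, simple and undirected. $e(G)$ denotes the number of edges of $G$. *)

(* Defs.v *)
From mathcomp Require Import all_boot.

Set Implicit Arguments.
Unset Strict Implicit.
Unset Printing Implicit Defensive.

(* A finite simple undirected graph is a symmetric, irreflexive relation on a
   finite type of vertices. *)
Definition simple_graph (T : finType) (e : rel T) : Prop :=
  symmetric e /\ irreflexive e.

Definition edges (T : finType) (e : rel T) : {set {set T}} :=
  [set [set p.1; p.2] | p : T * T & e p.1 p.2].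

Definition bipartition (T : finType) (e : rel T) (X Y : {set T}) : Prop :=
  [/\ X :|: Y = [set: T], [disjoint X & Y] &
      forall u v : T, e u v ->
        (u \in X) && (v \in Y) || (u \in Y) && (v \in X)].

(* The bound 3 <= l is needed because [ucycle] also accepts the empty sequence
   and the sequences [:: u; v] with e u v. *)
Definition has_cycle (T : finType) (e : rel T) (l : nat) : Prop :=
  exists s : seq T, [/\ 3 <= l, size s = l & ucycle e s].

(* Main.v *)
Require Import Defs.
From mathcomp Require Import all_boot.
From mathcomp Require Import zify.

(* Let t = m - k, so that t <= m <= 2t - 2, and take a minimal counterexample.
   Deleting a vertex of the larger class shows that both classes have m
   vertices, deleting a pair that deg x + deg y > t for x in X and y in Y, and
   counting the edges of the two lobes at a cut vertex that the graph is
   2-connected.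

   A connected balanced bipartite graph is Hamiltonian or has a path with ends
   u, v in different classes that contains all neighbours of u and v and has no
   crossing (consecutive p, q with v ~ p and u ~ q).  It is obtained from a
   longest path with, say, both ends outside X by leaving it at its last
   attachment q to a component with a majority in X and descending there to an
   X-vertex without new neighbours, after Pósa rotations have pushed q as far as
   possible.  As in Pósa's theorem, 2-connectedness turns this path into a cycle
   of length at least 2 (deg u + deg v - 1) >= 2t.

   To reach every even length, take a longest cycle C, of length 2c >= 2t.  If it
   is not Hamiltonian, some x in X, y in Y off C satisfy
   deg x + deg y - [x ~ y] <= m: otherwise the saturated-path lemma makes the
   complement of C Hamiltonian and attached to C so richly that C can be
   lengthened.  Deleting x and y preserves |E| > m (m + 1) / 2.  In the end C is
   Hamiltonian and Bondy's chord count gives all even lengths up to 2c. *)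

Set Implicit Arguments.
Unset Strict Implicit.
Unset Printing Implicit Defensive.

(** * Bipartite graphs, paths and crossings *)

(** Put c = t - 1. The edge bound becomes max * c + min < |E| + c, where max and min are the sizes
    of the two classes. This form is symmetric in the classes and makes sense for every induced
    subgraph. When min <= c even a complete bipartite graph stays below it, because the two sides
    differ by (max - 1)(c - min). So in a minimal counterexample every nonempty proper induced
    subgraph stays below it too, and each reduction is a comparison of two such bounds. The obstacle
    is that the graph need not be Hamiltonian, whereas the chord count needs a Hamiltonian cycle.
    The hypothesis m <= 2c weakens the bound to |E| > m (m + 1) / 2, which no longer mentions c and
    survives the deletion of a light pair. From then on c matters only through the first cycle: its
    length is at least m, so at most half of all vertices lie off a longest cycle. *)

Definition bigraph (T : finType) (e : rel T) (X : {set T}) : Prop :=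
  symmetric e /\ forall u v, e u v -> (u \in X) = (v \notin X).

Definition nb (T : finType) (e : rel T) (v : T) : {set T} := [set u | e v u].

Definition deg (T : finType) (e : rel T) (v : T) : nat := #|nb e v|.

(** Orienting each edge out of [X] counts it once and turns the count into a sum of degrees over one
    class. *)
Definition nedges (T : finType) (e : rel T) (X : {set T}) : nat :=
  #|[set p : T * T | (p.1 \in X) && e p.1 p.2]|.

Lemma rev_cons_last (T : Type) (x : T) p : rev (x :: p) = last x p :: rev (belast x p).
Proof. by rewrite [x :: p]lastI rev_rcons. Qed.

Lemma last_rev_belast (T : Type) (x : T) p : last (last x p) (rev (belast x p)) = x.
Proof. by case: p => //= y p; rewrite rev_cons last_rcons. Qed.

Section Basics.
Variables (T : finType) (e : rel T) (X : {set T}).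
Hypothesis bigr : bigraph e X.

Lemma bg_sym : symmetric e. Proof. by case: bigr. Qed.

Lemma bg_col u v : e u v -> (u \in X) = (v \notin X).
Proof. by case: bigr => _; apply. Qed.

Lemma bg_irr v : e v v = false.
Proof. by apply/negP => /bg_col; case: (v \in X). Qed.

(** The second class is always a complement, so this swap transfers every one-sided lemma to the
    other class. *)
Lemma bigraphC : bigraph e (~: X).
Proof. by split=> [|u v /bg_col]; [exact: bg_sym|rewrite !inE negbK => ->; rewrite negbK]. Qed.

Lemma nedges_sum : nedges e X = \sum_(x in X) deg e x.
Proof.
rewrite /nedges -sum1_card.
under eq_bigl do rewrite inE.
rewrite -(pair_big_dep (mem X) (fun x y => e x y) (fun _ _ => 1)) /=.
by apply: eq_bigr => x _; rewrite sum1_card; apply: eq_card => y; rewrite !inE.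
Qed.

Lemma nedgesC : nedges e (~: X) = nedges e X.
Proof.
have inj : injective (fun p : T * T => (p.2, p.1)) by move=> [a b] [c d] /= [-> ->].
rewrite /nedges -(card_imset _ inj); apply: eq_card => -[a b].
apply/imsetP/idP => [[[c d]] /=|].
  by rewrite !inE /= => /andP[cX ecd] [-> ->]; rewrite bg_sym ecd (bg_col ecd) in cX *; rewrite negbK in cX; rewrite cX.
rewrite !inE /= => /andP[aX eab]; exists (b, a) => //.
by rewrite !inE /= -(bg_col eab) aX bg_sym.
Qed.

Lemma rev_sortedS s : sorted e (rev s) = sorted e s.
Proof. by rewrite rev_sorted; apply: eq_sorted => x y; rewrite bg_sym. Qed.

Lemma rev_pathS x p : path e x p -> path e (last x p) (rev (belast x p)).
Proof. by rewrite rev_path (eq_path (e' := e)) // => u v /=; rewrite bg_sym. Qed.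

Lemma rev_pathS_cons x p y q :
  y :: q = rev (x :: p) -> path e x p -> path e y q.
Proof.
move=> E /rev_pathS; move: E; rewrite [x :: p]lastI rev_rcons.
by case=> <- <-.
Qed.

Lemma path_col x p : path e x p -> (last x p \in X) = (x \in X) (+) odd (size p).
Proof.
elim: p x => [|y p IH] x /=; first by rewrite addbF.
by move=> /andP[/bg_col -> /IH ->]; case: (y \in X); case: odd.
Qed.

Lemma path_count x p : path e x p -> count [in X] (belast x p) = count [predC X] p.
Proof.
elim: p x => [|y p IH] x //= /andP[/bg_col exy /IH ->].
by rewrite exy.
Qed.

Lemma cycle_count s : cycle e s -> count [in X] s = count [predC X] s.
Proof.
case: s => [|x p] //= /path_count; rewrite belast_rcons /= => ->.
by rewrite -cats1 count_cat /= addn0 addnC.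
Qed.

Lemma cycle_size s : cycle e s -> size s = (count [in X] s).*2.
Proof.
move=> /cycle_count E; rewrite -(count_predC [in X] s) -addnn; congr addn.
by rewrite E.
Qed.

Lemma deg_count v s : uniq s -> {subset nb e v <= s} -> deg e v = count (e v) s.
Proof.
move=> us sub; rewrite /deg -size_filter -(card_uniqP (filter_uniq _ us)).
apply: eq_card => u; rewrite mem_filter inE.
by case evu: (e v u) => //=; rewrite sub ?inE.
Qed.

End Basics.

Section Cross.
Variables (T : finType) (e : rel T) (X : {set T}).
Hypothesis bigr : bigraph e X.

(** The cycle follows the first segment from [x], jumps to the end of the second and returns along
    it to [q]. The segments need not be consecutive on a path: later uses skip a gap between
    them. *)
Lemma cross_ucycle (x q : T) (s1 s2 : seq T) :
  uniq (x :: s1 ++ q :: s2) -> path e x s1 -> path e q s2 -> e (last q s2) (last x s1) -> e x q ->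
  exists2 s, ucycle e s & perm_eq s (x :: s1 ++ q :: s2).
Proof.
move=> uw p1 p2 elp exq.
exists (x :: s1 ++ rev (q :: s2)); last first.
  by rewrite perm_cons perm_cat2l perm_rev.
rewrite /ucycle; apply/andP; split; last first.
  by rewrite (perm_uniq (s2 := x :: s1 ++ q :: s2)) // perm_cons perm_cat2l perm_rev.
rewrite rev_cons_last /cycle rcons_cat cat_path p1 /= (bg_sym bigr) elp /= -cats1 cat_path (rev_pathS bigr) //=.
by rewrite last_rev_belast (bg_sym bigr) exq.
Qed.

(** Opening the cycle at [a] gives a path that ends at [a] and can be prolonged by the tail [p]. *)
Lemma ucycle_tail_path (s : seq T) (a : T) (p : seq T) :
  ucycle e s -> a \in s -> path e a p -> uniq p -> ~~ has (mem s) p ->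
  exists x q, [/\ path e x q, uniq (x :: q), size (x :: q) = size s + size p
    & (x :: q) =i s ++ p].
Proof.
move=> /andP[cs us] as_ pp up dis.
have [i s' E] := rot_to as_.
have cs' : cycle e (a :: s') by rewrite -E rot_cycle.
have pe : perm_eq s (a :: s') by rewrite -E perm_sym perm_rot.
have us' : uniq (a :: s') by rewrite -(perm_uniq pe).
have pa : path e a s' by move: cs'; rewrite /cycle rcons_path => /andP[].
exists (last a s'), (rev (belast a s') ++ p); split.
- by rewrite cat_path (rev_pathS bigr) //= last_rev_belast.
- have -> : last a s' :: rev (belast a s') ++ p = rev (a :: s') ++ p by rewrite rev_cons_last.
  rewrite cat_uniq rev_uniq us' up andbT.
  apply: contra dis => /hasP[z zp] zs; apply/hasP; exists z => //=.
  by rewrite (perm_mem pe) -mem_rev.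
- by rewrite /= size_cat size_rev size_belast (perm_size pe).
- have -> : last a s' :: rev (belast a s') ++ p = rev (a :: s') ++ p by rewrite rev_cons_last.
  by move=> z; rewrite !mem_cat mem_rev (perm_mem pe).
Qed.

(* Along a path, a crossing is a consecutive pair [p, q] with [e v p] and
   [e u q]; without one each pair carries at most one neighbour. *)
Lemma noncross_count (u v x : T) (p : seq T) :
  path e x p -> u \notin X -> v \in X ->
  (forall s1 s2 a b, x :: p = s1 ++ a :: b :: s2 -> ~~ (e v a && e u b)) ->
  count (e v) (belast x p) + count (e u) p <= count [predC X] (belast x p).
Proof.
move=> + uX vX; elim: p x => [|y p IH] x //= /andP[exy pp] H.
have : count (e v) (belast y p) + count (e u) p <= count [predC X] (belast y p).
  by apply: (IH y pp) => s1 s2 a b E; apply: (H (x :: s1) s2 a b); rewrite E.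
have := H [::] p x y erefl.
have := bg_col bigr exy.
have : e v x -> x \notin X by move=> /(bg_col bigr) <-.
have : e u y -> y \in X by move=> /(bg_col bigr); rewrite (negbTE uX) => /esym/negbFE.
change (pred_of_simpl [predC X] x) with (x \notin X).
move: (count _ (belast y p)) (count _ p) (count _ (belast y p)) => n1 n2 n3.
by case: (e v x); case: (e u y); case: (x \in X); case: (y \in X) => //= h1 h2 h3 h4 h5;
  try (by have := h1 isT); try (by have := h2 isT); clear -h5; lia.
Qed.

End Cross.

(** * Components and saturated leaves *)

Lemma longest_seq (T : finType) (Q : pred (seq T)) s0 :
  (forall s, Q s -> uniq s) -> Q s0 ->
  exists2 s, Q s & forall s', Q s' -> size s' <= size s.
Proof.
move=> Qu Qs0.
pose P n := [exists t : n.-tuple T, Q t].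
have exP : exists n, P n by exists (size s0); apply/existsP; exists (in_tuple s0).
have ubP n : P n -> n <= #|T|.
  by move=> /existsP[t /Qu /card_uniqP]; rewrite size_tuple => <-; exact: max_card.
case: (ex_maxnP exP ubP) => n /existsP[t Qt] max_n.
exists t => // s' Qs'; rewrite size_tuple; apply: max_n.
by apply/existsP; exists (in_tuple s').
Qed.

Lemma has_split_last (T : eqType) (a : pred T) s :
  has a s -> exists s1 x s2, [/\ s = s1 ++ x :: s2, a x & ~~ has a s2].
Proof.
elim: s => // y s IH /=.
have [hs _|hs] := boolP (has a s).
  by have [s1 [x [s2 [-> ax h]]]] := IH hs; exists (y :: s1), x, s2.
by rewrite orbF => ay; exists [::], y, s.
Qed.

Lemma has_split_first (T : eqType) (a : pred T) s :
  has a s -> exists s1 x s2, [/\ s = s1 ++ x :: s2, a x & ~~ has a s1].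
Proof.
elim: s => // y s IH /=.
have [ay _|nay /= hs] := boolP (a y); first by exists [::], y, s.
have [s1 [x [s2 [-> ax h]]]] := IH hs; exists (y :: s1), x, s2.
by rewrite /= (negbTE nay).
Qed.

(** The cut form of connectivity: it directly supplies an attachment to a given vertex set. *)
Definition connected_graph (T : finType) (e : rel T) : Prop :=
  forall V : {set T}, V != set0 -> V != [set: T] ->
    exists a b, [/\ a \in V, b \notin V & e a b].

Definition rstr (T : finType) (e : rel T) (K : {set T}) : rel T :=
  [rel x y | [&& e x y, x \in K & y \in K]].

Lemma rstrE (T : finType) (e : rel T) K x y :
  rstr e K x y = [&& e x y, x \in K & y \in K].
Proof. by []. Qed.

Definition component (T : finType) (e : rel T) (K : {set T}) (z : T) : {set T} :=
  [set y in K | connect (rstr e K) z y].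

Section Components.
Variables (T : finType) (e : rel T) (X : {set T}).
Hypothesis bigr : bigraph e X.

Lemma rstr_sym K : connect_sym (rstr e K).
Proof.
apply: sym_connect_sym => x y; rewrite !rstrE.
by rewrite (bg_sym bigr) [(x \in K) && _]andbC.
Qed.

(** Sum over the components; a nonempty [K] has at least one, so the surplus [d] is gained at least
    once. It serves contrapositively, to find a component that is rich in [X]. *)
Lemma comps_weight (K : {set T}) d :
  K != set0 -> (forall z, z \in K -> #|component e K z :&: X| + d <= #|component e K z :\: X|) ->
  #|K :&: X| + d <= #|K :\: X|.
Proof.
move=> K0 H.
have eqR : {in K & &, equivalence_rel (connect (rstr e K))}.
  move=> x y z _ _ _; split=> [|xy]; first exact: connect0.
  by rewrite (same_connect (rstr_sym K) xy).
have /and3P[/eqP covP triP noP] := equivalence_partitionP eqR.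
set P := equivalence_partition _ K in covP triP noP.
have sumE (A Z : {set T}) : #|A :&: Z| = \sum_(z in A) (z \in Z).
  rewrite -sum1_card; under eq_bigl do rewrite inE.
  by rewrite big_mkcondr /=; apply: eq_bigr => z _; case: (z \in Z).
have PE (A : {set T}) : A \in P -> exists2 z, z \in K & A = component e K z.
  by move=> /imsetP[z zK ->]; exists z.
rewrite setDE !sumE -covP !(big_trivIset _ triP) /=.
have P0 : 0 < #|P|.
  rewrite lt0n cards_eq0; apply: contraNneq K0 => E.
  by rewrite -covP E /cover big_set0.
apply: (@leq_trans (\sum_(A in P) (\sum_(z in A) (z \in X) + d))).
  by rewrite big_split /= sum_nat_const leq_add2l leq_pmull.
apply: leq_sum => A /PE[z zK ->].
by move: (H z zK); rewrite setDE !sumE.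
Qed.

Lemma comp_path K z x p : x \in component e K z -> path (rstr e K) x p -> path (rstr e (component e K z)) x p.
Proof.
elim: p x => //= y p IH x xB /andP[/and3P[exy xK yK] pp].
have yB : y \in component e K z.
  move: xB; rewrite !inE => /andP[_ zx]; rewrite yK /=.
  by apply: connect_trans zx (connect1 _); rewrite rstrE exy xK yK.
by rewrite rstrE exy xB yB IH.
Qed.

(* Descend from [w] into a component of [K :\ w] that inherits the surplus of
   [X]-vertices. *)
Lemma leaf_path (K : {set T}) w :
  w \in K -> (forall z, z \in K -> connect (rstr e K) w z) ->
  #|K :\: X| < #|K :&: X| + (w \notin X) ->
  exists p, [/\ path e w p, uniq (w :: p), {subset w :: p <= K}, last w p \in X
    & forall z, z \in K -> e (last w p) z -> z \in w :: p].
Proof.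
move: {2}#|K| (leqnn #|K|) => n; elim: n K w => [|n IH] K w.
  by rewrite leqn0 cards_eq0 => /eqP ->; rewrite inE.
move=> leK wK conK wt.
pose K' := K :\ w.
have cardX : #|K :&: X| = (w \in X) + #|K' :&: X|.
  rewrite (cardsD1 w) !inE wK /=; congr (_ + _); apply: eq_card => z; rewrite !inE.
  by rewrite andbA.
have cardY : #|K :\: X| = (w \notin X) + #|K' :\: X|.
  rewrite (cardsD1 w) !inE wK andbT /=; congr (_ + _); apply: eq_card => z; rewrite !inE.
  by case: (z == w); case: (z \in X); case: (z \in K).
have [K'0|K'0] := eqVneq K' set0.
  exists [::]; split=> //=.
  - by move=> z; rewrite inE => /eqP ->.
  - apply: contraTT wt => wX; rewrite cardX cardY K'0 set0I set0D cards0 wX (negbTE wX); lia.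
  - move=> z zK _; rewrite inE; apply: contraTT zK => zw.
    by have := in_set0 z; rewrite -K'0 !inE zw /= => ->.
(* The term [(w \in X)] is the one the induction asks for: the next vertex [w1] lies in the other
   class than [w]. *)
have [z zK' wtz] : exists2 z, z \in K' & #|component e K' z :\: X| < #|component e K' z :&: X| + (w \in X).
  apply/exists_inP; apply: contraLR wt => /exists_inPn H.
  have : #|K' :&: X| + (w \in X) <= #|K' :\: X|.
    by apply: comps_weight K'0 _ => z zK'; rewrite leqNgt H.
  by rewrite cardX cardY -leqNgt; case: (w \in X); lia.
have [w1 ew1 w1B] : exists2 w1, e w w1 & w1 \in component e K' z.
  move: zK'; rewrite 2!inE => /andP[zw zK].
  have /connectP[p0 pp0 lz0] := conK z zK.
  move: zw; rewrite {}lz0 in zK *; case/shortenP: pp0 => -[|w1 p] //=; first by rewrite eqxx.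
  move=> /andP[/and3P[ew1 _ w1K] pp] /andP[wp up] _ _.
  exists w1 => //; move: wp; rewrite inE negb_or => /andP[ww1 wp].
  rewrite !inE eq_sym ww1 w1K /= rstr_sym; apply/connectP; exists p => //.
  elim: p (w1) ww1 w1K wp pp {up ew1} => //= y p IHp x wx xK.
  rewrite inE negb_or => /andP[wy wp] /andP[/and3P[exy _ yK] pp].
  by rewrite rstrE exy !inE ![_ == w]eq_sym wx wy xK yK /= IHp.
have BK' : {subset component e K' z <= K'} by move=> y; rewrite inE => /andP[].
have w1wX : (w1 \notin X) = (w \in X) by rewrite (bg_col bigr ew1).
have ltB : #|component e K' z| <= n.
  rewrite -ltnS; apply: leq_trans leK; rewrite [in leqRHS](cardsD1 w) wK add1n ltnS.
  by apply: subset_leq_card; apply/subsetP.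
have conB y : y \in component e K' z -> connect (rstr e (component e K' z)) w1 y.
  move=> yB; have : connect (rstr e K') w1 y.
    move: w1B yB; rewrite !inE => /andP[_ zw1] /andP[_ zy].
    by apply: connect_trans zy; rewrite rstr_sym.
  by move=> /connectP[p pp ->]; apply/connectP; exists p => //; apply: comp_path.
rewrite -w1wX in wtz.
have [p [pp up subp lp satp]] := IH _ w1 ltB w1B conB wtz.
exists (w1 :: p); split=> //.
- by rewrite /= ew1.
- rewrite cons_uniq up andbT; apply/negP => /subp/BK'.
  by rewrite !inE eqxx.
- move=> y; rewrite inE => /predU1P[-> //|/subp/BK'].
  by rewrite inE => /andP[].
- move=> y yK ey; rewrite inE; have [//|yw /=] := eqVneq y w.
  apply: satp => //.
  have : last w1 p \in component e K' z by apply: subp; exact: mem_last.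
  move=> lB; have lK' := BK' _ lB; move: lB; rewrite !inE yw yK /= => /andP[_ zl].
  by apply: connect_trans zl (connect1 _); rewrite rstrE ey lK' !inE yw.
Qed.

End Components.

(** * Saturated paths *)

Definition noncrossing (T : eqType) (e : rel T) (x : T) (p : seq T) : Prop :=
  forall s1 s2 a b, x :: p = s1 ++ a :: b :: s2 -> ~~ (e (last x p) a && e x b).

Lemma consecutive_dec (T : Type) (r : rel T) (s : seq T) :
  (forall s1 s2 a b, s = s1 ++ a :: b :: s2 -> ~~ r a b) \/
  (exists s1 s2 a b, s = s1 ++ a :: b :: s2 /\ r a b).
Proof.
elim: s => [|x s IH]; first by left; case=> [|? [|? ?]].
case: s IH => [|y s] [IH|[s1 [s2 [a [b [E rab]]]]]].
- by left; case=> [|? [|? ?]].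
- by case: s1 E => [|? [|? ?]].
- have [rxy|nxy] := boolP (r x y); first by right; exists [::], s, x, y.
  left=> -[|z s1] s2 a b /=; first by case=> <- <- _.
  by case=> _; exact: IH.
- by right; exists (x :: s1), s2, a, b; rewrite E.
Qed.

Lemma card_count (T : finType) (X : {set T}) s :
  uniq s -> #|[set z in s] :&: X| = count [in X] s.
Proof.
move=> us; rewrite -size_filter -(card_uniqP (filter_uniq _ us)).
by apply: eq_card => z; rewrite mem_filter !inE andbC.
Qed.

Section Saturated.
Variables (T : finType) (e : rel T) (X : {set T}).
Hypothesis bigr : bigraph e X.

Lemma noncrossing_or_ucycle x p : path e x p -> uniq (x :: p) ->
  noncrossing e x p \/ exists2 s, ucycle e s & perm_eq s (x :: p).
Proof.
move=> pp up.
have [|[s1 [s2 [a [b [E /andP[la xb]]]]]]] := consecutive_dec (fun a b => e (last x p) a && e x b) (x :: p).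
  by left.
right; rewrite -cat_rcons in E.
case Es: (rcons s1 a) E => [|x' t]; first by case: (s1) Es.
rewrite /= => -[Ex Ep]; subst x' p.
have lt : last x t = a by rewrite -(last_rcons x s1 a) Es.
move: pp la; rewrite cat_path last_cat /= => /and3P[pt _ ps2] la.
by apply: (cross_ucycle bigr up) => //; rewrite lt.
Qed.

Definition longest_path (x : T) (p : seq T) : Prop :=
  [/\ path e x p, uniq (x :: p) &
      forall y q, path e y q -> uniq (y :: q) -> size q <= size p].

Lemma longest_path_head x p y : longest_path x p -> e x y -> y \in x :: p.
Proof.
move=> [pp up mx] exy; apply: contraT => yp.
have /= := mx y (x :: p); rewrite -/(uniq (x :: p)) up yp (bg_sym bigr) exy pp.
by move=> /(_ isT isT); rewrite ltnn.
Qed.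

Lemma longest_path_last x p y : longest_path x p -> e (last x p) y -> y \in x :: p.
Proof.
move=> lp ely.
have [pp up mx] := lp.
have /longest_path_head : longest_path (last x p) (rev (belast x p)).
  split; first exact: (rev_pathS bigr).
  - by rewrite -rev_cons_last rev_uniq.
  - move=> z q pq uq; rewrite size_rev size_belast; exact: mx pq uq.
by move=> /(_ _ ely); rewrite -rev_cons_last mem_rev.
Qed.

Lemma longest_path_exists (x0 : T) : exists x p, longest_path x p.
Proof.
pose Q s := uniq s && sorted e s.
have Qu s : Q s -> uniq s by case/andP.
have [[|x p] /andP[up pp] mx] := @longest_seq T Q [:: x0] Qu isT.
  by have := mx [:: x0] isT.
exists x, p; split=> // y q pq uq.
by have := mx (y :: q); rewrite /Q uq /= pq; apply.
Qed.

(* Pósa rotations move the part of a longest path behind its last [a]-vertex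
   to the front until the first vertex sees none of it. *)
Lemma rotate_longest (a : pred T) Q1 q Q2 x p :
  x :: p = Q1 ++ q :: Q2 -> longest_path x p -> x \notin X -> ~~ odd (size p) ->
  ~~ has a Q2 ->
  exists Q1' Q2' x' p', [/\ x' :: p' = Q1' ++ q :: Q2', longest_path x' p', x' \notin X,
     (x' :: p') =i (x :: p) & ~~ has a Q2' && ~~ has (e x') Q2'].
Proof.
move: {2}(size Q2) (leqnn (size Q2)) => n; elim: n Q1 Q2 x p => [|n IH] Q1 Q2 x p.
  rewrite leqn0 size_eq0 => /eqP-> E lp xX _ _.
  by exists Q1, [::], x, p.
move=> leQ E lp xX op aQ2.
have [hx|hx] := boolP (has (e x) Q2); last by exists Q1, Q2, x, p; rewrite aQ2 hx.
have [Q2a [z [Q2b [E2 exz _]]]] := has_split_last hx.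
have [pp up mx] := lp.
(* The chord from [x] to [z] lets [z :: Q2b], reversed, precede [x]. The new first vertex is the old
   last one, outside [X] by parity, and only the shorter [Q2a] remains behind [q]. *)
pose x' := last z Q2b; pose p' := rev (belast z Q2b) ++ Q1 ++ q :: Q2a.
have El : x' = last x p.
  have <- : last x (x :: p) = last x p by [].
  by rewrite E E2 last_cat /= last_cat.
have perm : perm_eq (x' :: p') (x :: p).
  rewrite E E2 /p' -cat_cons -rev_cons_last -(perm_cat2r [::]) !cats0.
  apply/permP => f; rewrite !count_cat count_rev /= !count_cat /=; clear; lia.
have pp' : path e x' p'.
  rewrite cat_path (rev_pathS bigr); last first.
    have : sorted e (Q1 ++ q :: Q2a ++ z :: Q2b) by rewrite -E2 -E.
    by rewrite -cat_cons catA sorted_cat_cons => /andP[].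
  rewrite last_rev_belast /=.
  have : sorted e ((Q1 ++ q :: Q2a) ++ z :: Q2b) by rewrite -catA /= -E2 -E.
  rewrite sorted_cat_cons => /andP[+ _].
  case: Q1 E {p' perm} => [|y Q1] /= [Exy _]; subst.
    by rewrite (bg_sym bigr) exz rcons_path => /andP[].
  by rewrite (bg_sym bigr) exz rcons_path => /andP[].
have lp' : longest_path x' p'.
  split=> //; first by rewrite (perm_uniq perm).
  move=> y r pr ur; have := mx y r pr ur; have := perm_size perm => /= -[->] //.
have szE : size p' = size p by have := perm_size perm => /= -[].
have le2 : size Q2a <= n by rewrite -ltnS; apply: leq_trans leQ; rewrite E2 size_cat /= addnS ltnS leq_addr.
have E' : x' :: p' = (rev (z :: Q2b) ++ Q1) ++ q :: Q2a.
  by rewrite rev_cons_last -!catA.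
have x'X : x' \notin X by rewrite El (path_col bigr pp) (negbTE op) addbF.
have op' : ~~ odd (size p') by rewrite szE.
have aQ2a : ~~ has a Q2a by apply: contra aQ2; rewrite E2 has_cat => ->.
have [Q1' [Q2' [x1 [p1 [E1 l1 c1 m1 h1]]]]] := IH _ _ x' p' le2 E' lp' x'X op' aQ2a.
by exists Q1', Q2', x1, p1; split=> // y; rewrite m1 (perm_mem perm).
Qed.

Definition saturated_path (x : T) (p : seq T) : Prop :=
  [/\ path e x p, uniq (x :: p), {subset nb e x <= x :: p},
      {subset nb e (last x p) <= x :: p} & noncrossing e x p].

Hypothesis conn : connected_graph e.

(** A cycle that misses a vertex could be opened at an attachment and prolonged, giving a path
    longer than the longest one. *)
Lemma ucycle_longest s x p : longest_path x p -> ucycle e s -> size p < size s ->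
  size s = #|T|.
Proof.
move=> [pp up mx] cs lts.
have us : uniq s by case/andP: cs.
have [E|nE] := eqVneq [set z in s] [set: T].
  by rewrite -cardsT -E cardsE; apply/esym/card_uniqP.
have n0 : [set z in s] != set0.
  by case: s {cs us nE} lts => // y s _; apply/set0Pn; exists y; rewrite !inE eqxx.
have [a [b []]] := conn n0 nE; rewrite !inE => as_ bs eab.
have pab : path e a [:: b] by rewrite /= eab.
have dis : ~~ has (mem s) [:: b] by rewrite /= orbF.
have [y [q [pq uq sq _]]] := ucycle_tail_path bigr cs as_ pab isT dis.
have eqs : size q = size s by move: sq; rewrite /= addn1 => -[].
by have := leq_ltn_trans (mx y q pq uq) lts; rewrite eqs ltnn.
Qed.

(** With both ends outside [X] the path uses one vertex more outside [X] than in it, so some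
    component [K] of the rest has a majority in [X] and [leaf_path] applies there. The new path
    follows the old one to its last attachment [q] to [K] and then descends in [K]. Behind [q] lie
    no neighbours of its first vertex, by the rotations, and none of its last vertex, since nothing
    behind [q] is attached to [K]. *)
Lemma saturated_path_majority x p :
  #|X| = #|~: X| -> longest_path x p -> x \notin X -> ~~ odd (size p) ->
  exists y q, saturated_path y q /\ (y \in X) != (last y q \in X).
Proof.
move=> cX lp xX op.
have [pp up mx] := lp.
pose L := [set z in x :: p]; pose O := ~: L.
have cL : #|L :\: X| = #|L :&: X|.+1.
  rewrite setDE !card_count //.
  have lX : last x p \notin X by rewrite (path_col bigr pp) (negbTE op) addbF.
  have -> : count [in X] (x :: p) = count [in X] (belast x p).
    by rewrite lastI -cats1 count_cat /= (negbTE lX) !addn0.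
  rewrite (path_count bigr pp) /= inE xX /= add1n; congr S.
  by apply: eq_count => z; rewrite !inE.
have cO : #|O :\: X| < #|O :&: X|.
  have := cardsID L X; have := cardsID L (~: X).
  rewrite [X :\: L]setDE [~: X :\: L]setDE -/O ![_ :&: O]setIC ![_ :&: L]setIC -!setDE.
  by rewrite cL -cX; lia.
have O0 : O != set0 by apply: contraTneq cO => ->; rewrite set0I cards0.
have [z zO ltz] : exists2 z, z \in O & #|component e O z :\: X| < #|component e O z :&: X|.
  apply/exists_inP; apply: contraLR cO => /exists_inPn H.
  have : #|O :&: X| + 0 <= #|O :\: X|.
    by apply: (comps_weight bigr) O0 _ => z zO; rewrite addn0 leqNgt H.
  by rewrite addn0 -leqNgt.
pose K := component e O z.
have KO : {subset K <= O} by move=> y; rewrite inE => /andP[].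
have zK : z \in K by rewrite inE zO connect0.
have Kclosed a b : a \in K -> b \in O -> e a b -> b \in K.
  move=> aK bO eab; have aO := KO _ aK.
  move: aK; rewrite inE => /andP[_ za]; rewrite inE bO /=.
  by apply: connect_trans za (connect1 _); rewrite rstrE eab aO bO.
pose att b := [exists a, (a \in K) && e b a].
have hatt : has att (x :: p).
  have K0 : K != set0 by apply/set0Pn; exists z.
  have KT : K != [set: T].
    by apply: contraTneq (in_setT x) => <-; apply/negP => /KO; rewrite !inE eqxx.
  have [a [b [aK bK eab]]] := conn K0 KT.
  apply/hasP; exists b; last by apply/existsP; exists a; rewrite aK (bg_sym bigr).
  by apply: contraR bK => bL; apply: Kclosed eab => //; rewrite !inE -in_cons.
have [Q1 [q [Q2 [E attq nattQ2]]]] := has_split_last hatt.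
have [Q1' [Q2' [y [r [E' lr yX mr /andP[nQ2' nyQ2']]]]]] := rotate_longest E lp xX op nattQ2.
have [pr ur mxr] := lr.
have /existsP[w /andP[wK eqw]] := attq.
have conK a : a \in K -> connect (rstr e K) w a.
  move=> aK; have : connect (rstr e O) w a.
    move: wK aK; rewrite inE => /andP[_ zw]; rewrite inE => /andP[_ za].
    by apply: connect_trans za; rewrite (rstr_sym bigr).
  by move=> /connectP[s ps ->]; apply/connectP; exists s => //; apply: comp_path.
have wtK : #|K :\: X| < #|K :&: X| + (w \notin X) by apply: leq_trans ltz (leq_addr _ _).
have [B [pB uB subB lB satB]] := leaf_path bigr wK conK wtK.
have LK a : a \in x :: p -> a \notin K.
  by move=> aL; apply/negP => /KO; rewrite inE inE aL.
(* [Q1'] may be empty, in which case [q] itself is the first vertex [y]. *)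
pose t := behead (rcons Q1' q) ++ w :: B.
have Et : y :: t = Q1' ++ q :: w :: B.
  have Ey : rcons Q1' q = y :: behead (rcons Q1' q).
    by case: (Q1') E' => [|a l] /= [-> _].
  by rewrite -cat_rcons Ey.
have lt_ : last y t = last w B.
  by have := congr1 (last y) Et; rewrite last_cat.
have pt : path e y t.
  have : sorted e (Q1' ++ q :: w :: B).
    have : sorted e (Q1' ++ q :: Q2') by rewrite -E'.
    by rewrite !sorted_cat_cons /= eqw pB => /andP[-> _].
  by rewrite -Et.
have memB a : a \in w :: B -> a \notin y :: r.
  by move=> /subB; apply: contraL; rewrite mr; exact: LK.
have ut : uniq (y :: t).
  rewrite Et -cat_rcons cat_uniq uB andbT.
  move: ur; rewrite E' -cat_rcons cat_uniq => /and3P[-> _ _].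
  rewrite andTb; apply/hasPn => a /memB; apply: contra => aQ.
  by rewrite E' -cat_rcons mem_cat; apply/orP; left; exact: aQ.
exists y, t; split; last first.
  by rewrite lt_ lB (negbTE yX).
have satQ a : a \in y :: r -> a \notin Q2' -> a \in y :: t.
  rewrite E' Et !mem_cat [a \in q :: Q2']inE [a \in q :: _]inE.
  by move=> /or3P[->|->|->]; rewrite ?orbT.
split=> //.
- move=> a; rewrite inE => eya; apply: satQ; first exact: (longest_path_head lr).
  by apply: contra nyQ2' => aQ; apply/hasP; exists a.
- move=> a; rewrite inE lt_ => ela.
  have [aL|aL] := boolP (a \in x :: p).
    apply: satQ; first by rewrite mr.
    apply: contra nQ2' => aQ; apply/hasP; exists a => //.
    by apply/existsP; exists (last w B); rewrite subB ?mem_last // (bg_sym bigr).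
  have aK : a \in K.
    by apply: (Kclosed (last w B)) => //; [apply: subB; exact: mem_last|rewrite inE inE].
  by rewrite Et mem_cat inE satB ?orbT.
(* A crossing would close the new path to a cycle through [q]. Opened at [q] and prolonged by the
   discarded tail [Q2'], it would have all vertices of the longest path and those of [w :: B]
   besides. *)
have [//|[s cs ps]] := noncrossing_or_ucycle pt ut.
have qs : q \in s by rewrite (perm_mem ps) Et mem_cat inE eqxx orbT.
have pQ : path e q Q2' by have : sorted e (y :: r) := pr; rewrite E' sorted_cat_cons => /andP[].
have uQ : uniq Q2' by move: ur; rewrite E' cat_uniq /= => /and4P[].
have dis : ~~ has (mem s) Q2'.
  apply/hasPn => a aQ; rewrite /= (perm_mem ps) Et -cat_rcons mem_cat negb_or.
  move: ur; rewrite E' -cat_rcons cat_uniq => /and3P[_ /hasPn/(_ a aQ) /= -> _] /=.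
  by apply/negP => /memB; rewrite E' mem_cat inE aQ !orbT.
have [y' [q' [pq' uq' sq' _]]] := ucycle_tail_path bigr cs qs pQ uQ dis.
have := mxr y' q' pq' uq'.
have : size (y :: r) = size (Q1' ++ q :: Q2') by rewrite E'.
have : size (y' :: q') = size (Q1' ++ q :: w :: B) + size Q2' by rewrite sq' (perm_size ps) Et.
rewrite !size_cat /=; clear; lia.
Qed.

End Saturated.

(** A longest path of odd length has its ends in different classes and is saturated by maximality,
    unless a crossing closes it to a Hamiltonian cycle. Even length is the majority case, for [X] or
    for its complement. *)
Lemma ucycle_or_saturated (T : finType) (e : rel T) (X : {set T}) :
  bigraph e X -> connected_graph e -> #|X| = #|~: X| -> 0 < #|X| ->
  (exists2 s, ucycle e s & size s = #|T|) \/
  exists y q, saturated_path e y q /\ (y \in X) != (last y q \in X).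
Proof.
move=> bigr conn cX X0; have [x0 _] := card_gt0P X0.
have [x [p lp]] := longest_path_exists e x0.
have [pp up mx] := lp.
have [op|op] := boolP (odd (size p)); last first.
  right; have [xX|xX] := boolP (x \in X); last first.
    exact: (saturated_path_majority bigr conn cX lp xX op).
  have cX' : #|~: X| = #|~: (~: X)| by rewrite setCK.
  have xX' : x \notin ~: X by rewrite inE xX.
  have [y [q [sq]]] := saturated_path_majority (bigraphC bigr) conn cX' lp xX' op.
  by rewrite !inE => yq; exists y, q; split=> //; move: yq; case: (y \in X); case: (_ \in X).
have [nc|[s cs ps]] := noncrossing_or_ucycle bigr pp up.
  right; exists x, p; split; last by rewrite (path_col bigr pp) op; case: (x \in X).
  split=> // a; rewrite inE; first exact: (longest_path_head bigr lp).
  exact: (longest_path_last bigr lp).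
left; exists s => //; apply: (ucycle_longest bigr conn lp cs).
by rewrite (perm_size ps).
Qed.

(** * Ears *)

(** The cut form of the statement that deleting any single vertex [v] leaves a connected graph. *)
Definition two_connected (T : finType) (e : rel T) : Prop :=
  forall (v : T) (V : {set T}), v \notin V -> V != set0 ->
    (exists2 b, b \notin V & b != v) ->
    exists a b, [/\ a \in V, b \notin V, b != v & e a b].

(** In use, [A] is the initial segment of the saturated path up to the last neighbour [a] of its
    first vertex. One foot must stay at [a] for the final cycle to close. *)
Definition ear (T : finType) (e : rel T) (A : {set T}) (a z1 : T) (I : seq T) (z2 : T) : Prop :=
  [/\ path e z1 (rcons I z2), uniq (z1 :: rcons I z2), z1 \in A /\ z2 \in A,
      {in I, forall y, y \notin A} & (a == z1) || (a == z2)].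

Section Vine.
Variables (T : finType) (e : rel T) (X : {set T}).
Hypothesis bigr : bigraph e X.

(** The set reached from [S1] by steps that land outside [S1], [S2] and [v] has an outgoing edge
    that avoids [v]; its far end can lie only in [S2]. *)
Lemma bridge (S1 S2 : {set T}) v :
  two_connected e -> S1 != set0 -> S2 != set0 -> [disjoint S1 & S2] ->
  v \notin S1 -> v \notin S2 ->
  exists z p u, [/\ z \in S1, u \in S2, path e z (rcons p u), uniq (z :: rcons p u)
    & {in p, forall y, [&& y \notin S1, y \notin S2 & y != v]}].
Proof.
move=> conn2 S10 S20 dis v1 v2.
pose e' := [rel x y | [&& e x y, y \notin S1, y \notin S2 & y != v]].
pose R := [set y | [exists z, (z \in S1) && connect e' z y]].
have S1R z : z \in S1 -> z \in R.
  by move=> zS; rewrite inE; apply/existsP; exists z; rewrite zS connect0.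
have RP y : y \in R -> y \notin S1 -> [&& y \notin S2 & y != v].
  rewrite inE => /existsP[z /andP[zS /connectP[p]]].
  case/lastP: p => [|p y'] /=; first by move=> _ ->; rewrite zS.
  by rewrite rcons_path last_rcons => /andP[_ /and4P[_ _ y2 yv]] -> _; rewrite y2 yv.
have RS2 y : y \in R -> y \notin S2.
  move=> yR; have [yS1|/(RP _ yR)/andP[]//] := boolP (y \in S1).
  by rewrite (disjointFr dis yS1).
have vR : v \notin R.
  by apply/negP => /RP/(_ v1); rewrite eqxx andbF.
have R0 : R != set0.
  by have /set0Pn[z zS] := S10; apply/set0Pn; exists z; exact: S1R.
have Rb : exists2 b, b \notin R & b != v.
  have /set0Pn[b bS] := S20; exists b; last by apply: contraNneq v2 => <-.
  by apply: contraL bS; exact: RS2.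
have [a [u [aR uR uv eau]]] := conn2 v R vR R0 Rb.
have uS2 : u \in S2.
  apply: contraR uR => uS2.
  have [/S1R//|uS1] := boolP (u \in S1).
  move: aR; rewrite !inE => /existsP[z /andP[zS za]].
  apply/existsP; exists z; rewrite zS /=.
  by apply: connect_trans za (connect1 _); rewrite /= eau uS1 uS2 uv.
move: aR; rewrite inE => /existsP[z /andP[zS /connectP[p0 pp0 la]]].
rewrite {}la in eau.
case: (shortenP pp0) eau => p pp up _ eau.
have intp : {in p, forall y, [&& y \notin S1, y \notin S2 & y != v]}.
  elim: p (z) pp {up eau} => //= y p IH x /andP[/and4P[_ y1 y2 yv] pp] c.
  by rewrite inE => /predU1P[->|/(IH _ pp)//]; rewrite y1 y2 yv.
exists z, p, u; split=> //.
- rewrite rcons_path eau andbT; apply: sub_path pp => x y /= /andP[] //.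
- rewrite -rcons_cons rcons_uniq up andbT inE negb_or; apply/andP; split.
    by apply: contraTneq zS => <-; rewrite (disjointFl dis uS2).
  by apply/negP => /intp; rewrite uS2 andbF.
Qed.

Lemma ear_rev A a z1 I z2 : ear e A a z1 I z2 -> ear e A a z2 (rev I) z1.
Proof.
move=> [pI uI [z1A z2A] IA az].
have E : z2 :: rcons (rev I) z1 = rev (z1 :: rcons I z2).
  by rewrite rev_cons rev_rcons.
split=> //.
- exact: (rev_pathS_cons bigr E).
- by rewrite E rev_uniq.
- by move=> y; rewrite mem_rev; exact: IA.
- by rewrite orbC.
Qed.

(** The two sides of an unfinished ear: disjoint paths from feet in [A], one to [v] and one to [u]
    in [B]. A path piece from [v] to [u] inside [B] completes the ear. *)
Definition linkage (A B : {set T}) (a v z : T) (p : seq T) (z' : T) (p' : seq T) (u : T) : Prop :=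
  [/\ [/\ path e z p, last z p = v & path e z' (rcons p' u)], uniq ((z :: p) ++ z' :: p'),
      [/\ z \in A, z' \in A & (a == z) || (a == z')], {in p ++ p', forall y, y \notin A}
    & u \in B /\ {in (z :: p) ++ z' :: p', forall y, y \notin B}].

(** The bridge starts in [A], so it is a side of its own, and the ear is cut off at [v]. *)
Lemma link_A (A B : {set T}) a z1 I z2 v z p u :
  ear e A a z1 I z2 -> v \in z1 :: I -> z \in A -> z != z1 -> (a == z1) || (a == z) ->
  [disjoint B & A] -> {in z1 :: rcons I z2, forall y, y \notin B} ->
  path e z (rcons p u) -> uniq (z :: rcons p u) -> u \in B ->
  {in p, forall y, [&& y \notin A, y \notin z1 :: rcons I z2 & y \notin B]} ->
  exists p0, linkage A B a v z1 p0 z p u.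
Proof.
move=> [pI uI [z1A z2A] IA _] vI zA zz1 az BA LB pp up uB intp.
have [p0 [pp0 lp0 sub0 up0]] : exists p0, [/\ path e z1 p0, last z1 p0 = v, {subset p0 <= I} & uniq (z1 :: p0)].
  move: vI; rewrite inE => /predU1P[->|vI]; first by exists [::].
  exists (take (index v I).+1 I); split.
  - by move: pI; rewrite rcons_path => /andP[pI _]; exact: take_path.
  - by rewrite (take_nth v) ?index_mem // last_rcons nth_index.
  - by move=> y /mem_take.
  - move: uI; rewrite -rcons_cons rcons_uniq /= => /and3P[_ z1I uI].
    by rewrite take_uniq // andbT; apply: contra z1I => /mem_take.
have up' : uniq (z :: p) by move: up; rewrite -rcons_cons rcons_uniq => /andP[].
have LI y : y \in z1 :: p0 -> y \in z1 :: rcons I z2.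
  by rewrite !inE mem_rcons inE => /predU1P[->|/sub0 ->]; rewrite ?eqxx ?orbT.
exists p0; split=> //.
- rewrite cat_uniq up0 up' andbT andTb; apply/hasPn => y; rewrite inE => /predU1P[->|/intp].
    by rewrite /= inE (negbTE zz1) /=; apply/negP => /sub0/IA; rewrite zA.
  by case/and3P=> _ yL _; apply: contra yL => /LI.
- by move=> y; rewrite mem_cat => /orP[/sub0/IA//|/intp/and3P[]].
- split=> // y; rewrite mem_cat => /orP[/LI/LB//|]; rewrite inE => /predU1P[->|/intp/and3P[]//].
  by rewrite (disjointFl BA zA).
Qed.

(** The bridge branches off inside the ear. The part of the ear from [z1] to [z], which misses [v],
    is continued by the bridge; the other side comes from [z2] back to [v]. *)
Lemma link_I (A B : {set T}) a z1 I1 z I2 z2 v p u :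
  ear e A a z1 (I1 ++ z :: I2) z2 -> v \in rcons I2 z2 ->
  {in z1 :: rcons (I1 ++ z :: I2) z2, forall y, y \notin B} ->
  path e z (rcons p u) -> uniq (z :: rcons p u) -> u \in B ->
  {in p, forall y, [&& y \notin A, y \notin z1 :: rcons (I1 ++ z :: I2) z2 & y \notin B]} ->
  exists p0, linkage A B a v z2 p0 z1 (I1 ++ z :: p) u.
Proof.
move=> [pI uI [z1A z2A] IA az] vI LB pp up uB intp.
have [q [E pq]] : exists q, rev (rcons I2 z2) = z2 :: q /\ path e z2 q.
  exists (rev I2); rewrite rev_rcons; split=> //.
  move: pI; rewrite rcons_cat cat_path rcons_cons /= => /and3P[_ _ pI].
  by rewrite -[path _ _ _]/(sorted e (z2 :: rev I2)) -rev_rcons (rev_sortedS bigr) (path_sorted pI).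
have vq : v \in z2 :: q by rewrite -E mem_rev.
pose p0 := take (index v (z2 :: q)) q.
have pE : z2 :: p0 = take (index v (z2 :: q)).+1 (z2 :: q) by [].
have lp0 : last z2 p0 = v.
  have := congr1 (last z2) pE; rewrite /= => ->.
  have -> : last z2 (take (index v (z2 :: q)) q) = last z2 (take (index v (z2 :: q)).+1 (z2 :: q)) by [].
  by rewrite (take_nth v) ?index_mem // last_rcons nth_index.
have up0 : uniq (z2 :: p0).
  rewrite pE take_uniq // -E rev_uniq.
  by move: uI; rewrite rcons_cat -cat_cons cat_uniq => /and3P[_ _] /=; case/andP.
have sub0 y : y \in z2 :: p0 -> y \in rcons I2 z2.
  by rewrite pE => /mem_take; rewrite -E mem_rev.
have sub0' y : y \in p0 -> y \in I2.
  move=> yp; have := sub0 y; rewrite inE yp orbT mem_rcons inE => /(_ isT)/predU1P[yz|//].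
  by move: up0; rewrite cons_uniq -yz yp.
have uI' : uniq ((z1 :: I1) ++ z :: rcons I2 z2) by rewrite cat_cons -rcons_cons -rcons_cat.
have LL y : y \in z1 :: rcons (I1 ++ z :: I2) z2 = (y \in (z1 :: I1)) || (y == z) || (y \in rcons I2 z2).
  by rewrite rcons_cat -cat_cons mem_cat rcons_cons inE orbA.
have up' : uniq (z :: p) by move: up; rewrite -rcons_cons rcons_uniq => /andP[].
exists p0; split=> //.
- split=> //.
    by apply: take_path.
  move: pI; rewrite !rcons_cat !cat_path !rcons_cons /= => /and3P[-> -> _].
  exact: pp.
- have -> : z1 :: I1 ++ z :: p = (z1 :: I1) ++ z :: p by [].
  move: uI'; rewrite cat_uniq => /and3P[u1 h1]; rewrite cons_uniq => /andP[zI2 uI2].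
  rewrite uniq_catC -catA cat_uniq u1 cat_uniq up' up0 andTb !andbT.
  apply/andP; split; apply/hasPn => y.
    rewrite mem_cat => /orP[|/sub0 yI2].
      rewrite inE => /predU1P[->|/intp/and3P[_ + _]].
        by apply: (hasPn h1 z); rewrite inE eqxx.
      by apply: contra; rewrite LL => ->.
    by apply: (hasPn h1 y); rewrite inE yI2 orbT.
  move=> /sub0 yI2; rewrite inE negb_or; apply/andP; split.
    by apply: contraNneq zI2 => <-.
  by apply/negP => /intp/and3P[_ + _]; rewrite LL yI2 orbT.
- by split=> //; rewrite orbC.
- move=> y; rewrite !mem_cat inE => /or3P[/sub0' yI2|yI|/predU1P[->|/intp/and3P[]//]]; apply: IA.
  + by rewrite mem_cat inE yI2 !orbT.
  + by rewrite mem_cat yI.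
  + by rewrite mem_cat inE eqxx orbT.
- split=> // y; rewrite mem_cat -cat_cons mem_cat => /or3P[/sub0 yI2|yI|].
  + by apply: LB; rewrite LL yI2 orbT.
  + by apply: LB; rewrite LL yI.
  + rewrite inE => /predU1P[->|/intp/and3P[]//].
    by apply: LB; rewrite LL eqxx orbT.
Qed.

Hypothesis conn2 : two_connected e.

(** Deleting [v] leaves a bridge from [A] or the ear to [B]. Its starting point decides between
    [link_A] and [link_I], and reversing the ear covers the other position of [v]. *)
Lemma ear_step (A B : {set T}) a z1 I z2 v :
  ear e A a z1 I z2 -> v \in z1 :: rcons I z2 -> (v \in A -> v = a) -> B != set0 ->
  [disjoint B & A] -> {in z1 :: rcons I z2, forall y, y \notin B} ->
  exists z p z' p' u, linkage A B a v z p z' p' u.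
Proof.
move=> earI vL vA B0 BA LB.
have [pI uI [z1A z2A] IA az] := earI.
have z12 : z1 != z2 by move: uI; rewrite /= mem_rcons inE negb_or => /andP[/andP[]].
pose S := (A :|: [set y in z1 :: rcons I z2]) :\ v.
have S0 : S != set0.
  apply/set0Pn; have [E|zv] := eqVneq z1 v.
    by exists z2; rewrite !inE -E eq_sym z12 z2A.
  by exists z1; rewrite !inE zv z1A.
have SB : [disjoint S & B].
  rewrite disjoint_subset; apply/subsetP => y; rewrite !inE => /andP[_ /orP[yA|yL]].
    by rewrite (disjointFl BA yA).
  by apply: LB; rewrite inE.
have vS : v \notin S by rewrite !inE eqxx.
have [z [p [u [zS uB pp up intp]]]] := bridge conn2 S0 B0 SB vS (LB v vL).
have intp' : {in p, forall y, [&& y \notin A, y \notin z1 :: rcons I z2 & y \notin B]}.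
  move=> y /intp; rewrite in_setD1 in_setU [y \in [set _ in _]]inE => /and3P[+ -> yv].
  by rewrite yv /= negb_or => /andP[-> ->].
have intr : {in p, forall y, [&& y \notin A, y \notin z2 :: rcons (rev I) z1 & y \notin B]}.
  move=> y /intp'; suff -> : (y \in z2 :: rcons (rev I) z1) = (y \in z1 :: rcons I z2) by [].
  by rewrite !(inE, mem_rcons) mem_rev orbCA.
have LBr : {in z2 :: rcons (rev I) z1, forall y, y \notin B}.
  by move=> y yL; apply: LB; move: yL; rewrite !(inE, mem_rcons) mem_rev orbCA.
have earR := ear_rev earI.
move: zS; rewrite in_setD1 in_setU => /andP[zv].
have [zA _|zA /=] := boolP (z \in A).
  (* If [v] were [z2] it would lie in [A] and equal [a], but [a] is then [z1] or [z], both different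
     from [v]. *)
  have vz2 : (a == z1) || (a == z) -> v \in z1 :: I.
    move: vL; rewrite -rcons_cons mem_rcons inE => /predU1P[vz|//].
    have va : v = a by apply: vA; rewrite vz.
    by rewrite -va vz [z2 == _]eq_sym (negbTE z12) -vz eq_sym (negbTE zv).
  have vz1 : (a == z2) || (a == z) -> v \in z2 :: rev I.
    move: vL; rewrite !inE mem_rcons inE mem_rev => /orP[/eqP vz|//].
    have va : v = a by apply: vA; rewrite vz.
    by rewrite -va vz (negbTE z12) -vz eq_sym (negbTE zv).
  (* The foot of the old ear that is kept must differ from [z], and one of the two must be [a]. *)
  have [E|nz] := eqVneq z z1.
    have a2 : (a == z2) || (a == z) by rewrite E orbC.
    have zz2 : z != z2 by rewrite E.
    have [p0 L] := link_A earR (vz1 a2) zA zz2 a2 BA LBr pp up uB intr.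
    by exists z2, p0, z, p, u.
  have [a1|na1] := boolP ((a == z1) || (a == z)).
    have [p0 L] := link_A earI (vz2 a1) zA nz a1 BA LB pp up uB intp'.
    by exists z1, p0, z, p, u.
  move: na1; rewrite negb_or => /andP[az1 aznz].
  have a2 : (a == z2) || (a == z) by move: az; rewrite (negbTE az1) /= => ->.
  have zz2 : z != z2 by move: az; rewrite (negbTE az1) /= => /eqP <-; rewrite eq_sym.
  have [p0 L] := link_A earR (vz1 a2) zA zz2 a2 BA LBr pp up uB intr.
  by exists z2, p0, z, p, u.
rewrite inE => zL.
have zI : z \in I.
  move: zL; rewrite inE mem_rcons inE => /or3P[/eqP E|/eqP E|//].
    by rewrite E z1A in zA.
  by rewrite E z2A in zA.
case/splitPr: zI earI earR vL LB LBr intp' intr {pI uI IA vS S0 SB intp S zL} => I1 I2 earI earR vL LB LBr intp' intr.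
have [vI2|vI2] := boolP (v \in rcons I2 z2).
  have [p0 L] := link_I earI vI2 LB pp up uB intp'.
  by exists z2, p0, z1, (I1 ++ z :: p), u.
have vI1 : v \in rcons (rev I1) z1.
  move: vL; rewrite rcons_cat -cat_cons mem_cat rcons_cons [v \in z :: _]in_cons (negbTE vI2) eq_sym (negbTE zv) !orbF.
  by rewrite mem_rcons !inE mem_rev.
have RE : rev (I1 ++ z :: I2) = rev I2 ++ z :: rev I1 by rewrite rev_cat rev_cons cat_rcons.
rewrite RE in earR LBr intr.
have [p0 L] := link_I earR vI1 LBr pp up uB intr.
by exists z1, p0, z2, (rev I2 ++ z :: p), u.
Qed.

Lemma ear_join (A B : {set T}) a v z p z' p' u t :
  linkage A B a v z p z' p' u -> path e v (rcons t u) -> uniq (rcons t u) ->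
  {in rcons t u, forall y, y \in B} -> [disjoint B & A] ->
  ear e A a z (p ++ rcons t u ++ rev p') z'.
Proof.
move=> [[pp lp pp'] ul [zA z'A az] intA [uB nB]] pt ut tB BA.
have E : rev (z' :: rcons p' u) = u :: rcons (rev p') z' by rewrite rev_cons rev_rcons.
split=> //.
- rewrite rcons_cat cat_path pp lp rcons_cat cat_path pt last_rcons /=.
  exact: (rev_pathS_cons bigr (esym E) pp').
- have -> : z :: rcons (p ++ rcons t u ++ rev p') z' = (z :: p) ++ rcons t u ++ rev (z' :: p').
    by rewrite rev_cons !rcons_cat.
  rewrite uniq_catCA cat_uniq ut andTb; apply/andP; split.
    apply/hasPn => y; rewrite mem_cat mem_rev -mem_cat => /nB yB.
    by apply: contra yB => /tB.
  by rewrite (perm_uniq (s2 := (z :: p) ++ z' :: p')) // perm_cat2l perm_rev.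
- move=> y; rewrite !mem_cat mem_rev orbCA => /orP[/tB yB|]; first by rewrite (disjointFr BA yB).
  by rewrite -mem_cat; exact: intA.
Qed.

End Vine.

(** * Long cycles in 2-connected graphs *)

Section Circumference.
Variables (T : finType) (e : rel T) (X : {set T}).
Hypothesis bigr : bigraph e X.
Hypothesis conn2 : two_connected e.

(* The ear passes through the current path vertex [v] and avoids the rest [R] of
   the path; deleting [v] leaves a bridge from it to [R], along which it is
   pushed forward until it meets the neighbours of the last vertex. *)
Lemma vine (A : {set T}) a v R z1 I z2 :
  path e v R -> uniq (v :: R) -> ear e A a z1 I z2 -> v \in z1 :: rcons I z2 ->
  (v \in A -> v = a) -> {in R, forall y, y \notin A} ->
  {in R, forall y, y \notin z1 :: rcons I z2} -> has (e (last v R)) (v :: R) ->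
  exists y1 J y2, ear e A a y1 J y2 /\
    {in v :: R, forall c, e (last v R) c -> c \in y1 :: rcons J y2}.
Proof.
move: {2}(size R) (leqnn (size R)) => n; elim: n v R z1 I z2 => [|n IH] v R z1 I z2.
  by rewrite leqn0 => /nilP-> _ _ _ _ _ _ _; rewrite /= (bg_irr bigr).
move=> leR pR uR earI vI vA RA RI hR.
have [R0|R0] := eqVneq R [::]; first by move: hR; rewrite R0 /= (bg_irr bigr).
pose B := [set y in R].
have B0 : B != set0 by case: (R) @B R0 => // y l B _; apply/set0Pn; exists y; rewrite !inE eqxx.
have BA : [disjoint B & A].
  by rewrite disjoint_subset; apply/subsetP => y; rewrite inE => /RA yA; rewrite inE.
have IB : {in z1 :: rcons I z2, forall y, y \notin B}.
  by move=> y yI; rewrite inE; apply/negP => /RI; rewrite yI.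
have [z [p [z' [p' [u lk]]]]] := ear_step bigr conn2 earI vI vA B0 BA IB.
have [[pp lp pp'] ul _ _ [uB nB]] := lk.
move: uB; rewrite inE => uR'.
have [r1 [r2 ER]] : exists r1 r2, R = r1 ++ u :: r2.
  by case/splitPr: uR' => r1 r2; exists r1, r2.
set w := last v R in hR *.
have Ew : w = last u r2 by rewrite /w ER last_cat.
have [pr1 eu pr2] : [/\ path e v r1, e (last v r1) u & path e u r2].
  by move: pR; rewrite ER cat_path /= => /and3P[].
(* If the end [w] has neighbours before [u], let [j] be the last of them: from [v] the ear goes on
   to [j], jumps to [w] and returns along the path to [u]. It skips only [c2], which contains no
   neighbour of [w]. *)
have [h1|h1] := boolP (has (e w) (v :: r1)).
  have [c1 [j [c2 [E ewj nc2]]]] := has_split_last h1.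
  pose t0 := behead (rcons c1 j).
  have Et0 : rcons c1 j = v :: t0 by rewrite /t0; case: (c1) E => [|x l] /= [-> _].
  have Er1 : r1 = t0 ++ c2.
    by move: E; rewrite -cat_rcons Et0 => -[].
  pose t := t0 ++ rev r2.
  have Et : rcons t u = t0 ++ rev (u :: r2) by rewrite /t rcons_cat rev_cons.
  have lt0 : last v t0 = j by have := last_rcons v c1 j; rewrite Et0.
  have tR : {subset rcons t u <= R}.
    by move=> y; rewrite Et ER Er1 !mem_cat mem_rev => /orP[->|->]; rewrite ?orbT.
  have uR2 : uniq R by case/andP: uR.
  have ear' : ear e A a z (p ++ rcons t u ++ rev p') z'.
    apply: (ear_join bigr lk) => //.
    - rewrite Et cat_path; move: pr1; rewrite Er1 cat_path => /andP[-> _] /=.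
      by rewrite rev_cons_last /= lt0 (rev_pathS bigr) // -Ew (bg_sym bigr) ewj.
    - rewrite Et (perm_uniq (s2 := t0 ++ u :: r2)) ?perm_cat2l ?perm_rev //.
      move: uR2; rewrite ER Er1 -catA; apply: subseq_uniq.
      by rewrite -[X in subseq X _]/(t0 ++ [::] ++ u :: r2) !cat_subseq ?sub0seq.
    - by move=> y /tR yR; rewrite inE.
  exists z, (p ++ rcons t u ++ rev p'), z'; split=> // c.
  have vin : v \in z :: p by rewrite -lp mem_last.
  have main : c \in rcons t u -> c \in z :: rcons (p ++ rcons t u ++ rev p') z'.
    by move=> ct; rewrite inE mem_rcons inE !mem_cat ct !orbT.
  rewrite inE => /predU1P[->|]; first by move=> _; rewrite rcons_cat -cat_cons mem_cat vin.
  rewrite ER Er1 -catA !mem_cat => /or3P[ct|cc|cu] ewc.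
  - by apply: main; rewrite Et mem_cat ct.
  - by case/hasP: nc2; exists c.
  - by apply: main; rewrite Et mem_cat mem_rev cu orbT.
have uR2 : uniq R by case/andP: uR.
have tR : {subset rcons r1 u <= R}.
  by move=> y yr; rewrite ER -cat_rcons mem_cat yr.
(* All neighbours of [w] on [v :: R] now lie from [u] on. The ear absorbs [r1] and the induction
   continues at [u]. *)
have ear' : ear e A a z (p ++ rcons r1 u ++ rev p') z'.
  apply: (ear_join bigr lk) => //.
  - by rewrite rcons_path pr1.
  - by move: uR2; rewrite ER -cat_rcons cat_uniq => /andP[].
  - by move=> y /tR yR; rewrite inE.
have le2 : size r2 <= n.
  by rewrite -ltnS; apply: leq_trans leR; rewrite ER size_cat /= addnS ltnS leq_addl.
have uu2 : uniq (u :: r2) by move: uR2; rewrite ER cat_uniq => /and3P[].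
have sub2 : {subset u :: r2 <= R} by move=> y yr; rewrite ER mem_cat yr orbT.
have uin : u \in z :: rcons (p ++ rcons r1 u ++ rev p') z'.
  by rewrite inE mem_rcons inE !mem_cat mem_rcons inE eqxx !orbT.
have uA : u \in A -> u = a by move=> uA; have := RA u uR'; rewrite uA.
have r2A : {in r2, forall y, y \notin A} by move=> y yr; apply: RA; apply: sub2; rewrite inE yr orbT.
have r2E : {in r2, forall y, y \notin z :: rcons (p ++ rcons r1 u ++ rev p') z'}.
  move=> y yr; have yB : y \in B by rewrite inE sub2 // inE yr orbT.
  have nE : y \notin (z :: p) ++ z' :: p' by apply/negP => /nB; rewrite yB.
  have : y \notin rcons r1 u.
    by move: uR2; rewrite ER -cat_rcons cat_uniq => /and3P[_ /hasPn/(_ y yr) + _].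
  move: nE; rewrite !(mem_cat, inE, mem_rcons, mem_rev) !negb_or.
  by case: (y == z); case: (y \in p); case: (y == z'); case: (y \in p');
    case: (y == u); case: (y \in r1).
have h2 : has (e (last u r2)) (u :: r2).
  by move: hR; rewrite ER -cat_cons has_cat (negbTE h1) Ew.
have [y1 [J [y2 [earJ covJ]]]] := IH u r2 _ _ _ le2 pr2 uu2 ear' uin uA r2A r2E h2.
exists y1, J, y2; split=> // c.
rewrite ER -cat_cons mem_cat => /orP[cr ewc|cr ewc].
  by case/hasP: h1; exists c.
by apply: covJ; rewrite -?Ew.
Qed.


Lemma count_nbX v (s : seq T) : v \notin X -> count (e v) s <= count [in X] s.
Proof.
move=> vX; apply: sub_count => y /(bg_col bigr); rewrite (negbTE vX) => /esym/negbFE.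
exact.
Qed.

Lemma count_nbY v (s : seq T) : v \in X -> count (e v) s <= count [predC X] s.
Proof. by move=> vX; apply: sub_count => y /(bg_col bigr); rewrite vX /= => <-. Qed.

Lemma path_countY x p : path e x p -> count [predC X] (belast x p) = count [in X] p.
Proof.
move=> /(path_count (bigraphC bigr)) E.
transitivity (count [in ~: X] (belast x p)); first by apply: eq_count => y; rewrite !inE.
by rewrite E; apply: eq_count => y; rewrite !inE negbK.
Qed.

Lemma count_belast_le (f : pred T) x p : count f (belast x p) <= count f (x :: p).
Proof. by rewrite lastI -cats1 count_cat leq_addr. Qed.

(** With the ear starting at [a], let [i] be the first neighbour of [x] behind the other foot [z2].
    The cycle runs from [i] to [a], through the ear to [z2], back to [x] and over to [i]. It
    contains all neighbours of [x] and of [v], the latter inside [I]. *)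
Lemma close_ear x A1 a z1 I z2 v :
  path e x A1 -> uniq (x :: A1) -> last x A1 = a -> e x a -> x \notin X -> v \in X ->
  {subset nb e x <= x :: A1} -> {in x :: A1, forall y, ~~ e v y} ->
  ear e [set y in x :: A1] a z1 I z2 -> {subset nb e v <= z1 :: rcons I z2} ->
  exists2 s, ucycle e s & (deg e x + deg e v).*2 <= (size s).+2.
Proof.
move=> pA uA lA exa xX vX sx nv earI sv.
wlog za : z1 I z2 earI sv / z1 = a.
  move=> W; have [_ _ _ _ /orP[/eqP az|/eqP az]] := earI; first exact: W earI sv (esym az).
  apply: (W _ _ _ (ear_rev bigr earI)) => //.
  by move=> y /sv; rewrite !(inE, mem_rcons) mem_rev orbCA.
subst z1.
have [pI uI [aA z2A] IA _] := earI.
have z2a : z2 != a.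
  by move: uI; rewrite /= mem_rcons inE negb_or eq_sym => /andP[/andP[]].
have EA : x :: A1 = rcons (belast x A1) a by rewrite lastI lA.
have z2A1 : z2 \in belast x A1.
  by move: z2A; rewrite inE EA mem_rcons inE (negbTE z2a).
have [S1 [S2 ES]] : exists S1 S2, belast x A1 = S1 ++ z2 :: S2.
  by case/splitPr: z2A1 => S1 S2; exists S1, S2.
have hx : has (e x) (rcons S2 a) by rewrite has_rcons exa.
have [D1 [i [D2 [ED exi nD1]]]] := has_split_first hx.
have EA2 : x :: A1 = rcons S1 z2 ++ D1 ++ i :: D2.
  by rewrite EA ES rcons_cat rcons_cons ED cat_rcons.
pose L1 := behead (rcons S1 z2).
have EL : rcons S1 z2 = x :: L1.
  by rewrite /L1; case: (S1) EA2 => [|y l] /= [-> _].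
have EA3 : A1 = L1 ++ D1 ++ i :: D2 by move: EA2; rewrite EL => -[].
have lL : last x L1 = z2 by have := last_rcons x S1 z2; rewrite EL.
have lD : last i D2 = a.
  by rewrite -lA EA3 !last_cat.
have pL : path e x L1 by move: pA; rewrite EA3 cat_path => /andP[].
have pD : path e i D2 by move: pA; rewrite EA3 !cat_path /= => /and3P[_ _ /andP[]].
pose s := (i :: D2) ++ I ++ rev (x :: L1).
have ucs : ucycle e s.
  rewrite /s; apply/andP; split.
    rewrite rev_cons_last lL /cycle /= !rcons_cat !cat_path pD lD /=.
    move: pI; rewrite rcons_path => /andP[-> ->] /=.
    rewrite rcons_path -{1}lL (rev_pathS bigr) //= -lL last_rev_belast.
    by rewrite exi.
  rewrite catA uniq_catC.
  have /and3P[u1 u2 u3] : [&& uniq (x :: L1), ~~ has [in x :: L1] (i :: D2) & uniq (i :: D2)].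
    rewrite -cat_uniq; move: uA; rewrite EA2 EL; apply: subseq_uniq.
    by rewrite -[X in subseq X _]/((x :: L1) ++ [::] ++ i :: D2) !cat_subseq ?sub0seq.
  have inA y : y \in (x :: L1) ++ i :: D2 -> y \notin I.
    move=> yA; apply/negP => /IA/negP; apply.
    rewrite inE EA2 EL mem_cat; move: yA; rewrite !mem_cat => /orP[->|->] //.
    by rewrite !orbT.
  rewrite cat_uniq rev_uniq u1 andTb cat_uniq u3 andTb; apply/and3P; split.
  - apply/hasPn => y; rewrite mem_cat => /orP[yD|yI].
      by have := hasPn u2 y yD; rewrite /= !inE mem_rev inE.
    by rewrite /= mem_rev; apply/negP => yL; have := inA y; rewrite mem_cat yL yI => /(_ isT).
  - apply/hasPn => y yI; apply/negP => yD; have := inA y; rewrite mem_cat yI => /(_ _)/negP; apply=> //.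
    by rewrite [y \in i :: D2]yD orbT.
  - by move: uI; rewrite cons_uniq rcons_uniq => /and3P[].
exists s => //.
have cs := cycle_count bigr (ucycle_cycle ucs).
(* The path predecessor of a neighbour of [x] lies outside [X]. It is on the cycle for every
   neighbour except possibly [i], whence the loss of one. *)
have dx : deg e x <= count [predC X] (x :: L1) + (count [predC X] (i :: D2)).+1.
  rewrite (deg_count uA sx) EA2 EL !count_cat.
  have -> : count (e x) D1 = 0.
    by apply/eqP; rewrite -leqn0 leqNgt -has_count.
  rewrite add0n leq_add //.
    rewrite [count (e x) (x :: L1)]/= (bg_irr bigr) add0n.
    apply: leq_trans (count_nbX _ xX) _.
    by rewrite -(path_countY pL) count_belast_le.
  rewrite [count (e x) (i :: D2)]/= exi add1n ltnS.
  apply: leq_trans (count_nbX _ xX) _.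
  by rewrite -(path_countY pD) count_belast_le.
have dv : deg e v <= count [predC X] I.
  have uI' : uniq I by move: uI; rewrite cons_uniq rcons_uniq => /and3P[].
  rewrite (deg_count uI'); first exact: count_nbY.
  move=> y yv; have := sv y yv; rewrite !(inE, mem_rcons).
  move: yv; rewrite inE => evy /or3P[/eqP E|/eqP E|//].
    by have := nv a; rewrite EA mem_rcons inE eqxx -E evy => /(_ isT).
  by have := nv z2; rewrite EA mem_rcons inE z2A1 orbT -E evy => /(_ isT).
have ss : size s = (count [predC X] s).*2.
  by rewrite -(count_predC [in X] s) -addnn cs.
rewrite ss /s !count_cat count_rev.
move: dx dv; clear.
move: (count _ (x :: L1)) (count _ (i :: D2)) (count _ I) => n1 n2 n3; lia.
Qed.

(** Let [a] be the last neighbour of [x]. If [v] has a neighbour before [a], take the last such [j]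
    and the first neighbour [i] of [x] behind it: the gap holds no neighbour of either end, and the
    crossing cycle around it is long. Otherwise all neighbours of [v] lie behind [a], and a vine
    reaches over [a]. *)
Lemma saturated_ucycle x p :
  saturated_path e x p -> x \notin X -> last x p \in X ->
  exists2 s, ucycle e s & (deg e x + deg e (last x p)).*2 <= (size s).+2.
Proof.
move=> [pp up sx sv nc] xX; set v := last x p in sv *; move=> vX.
have pn : p <> [::] by move=> E; move: vX; rewrite /v E /= (negbTE xX).
have hx : has (e x) (x :: p) by case: (p) pp pn => //= y l /andP[-> _] _; rewrite orbT.
have [A1 [a [R [E exa nR]]]] := has_split_last hx.
have xa : x != a by apply/eqP => xa; move: exa; rewrite xa (bg_irr bigr).
have [A2 EA] : exists A2, A1 = x :: A2.
  by case: A1 E => [|y l] [Exa _]; [rewrite Exa eqxx in xa|exists l; rewrite Exa].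
have aX : a \in X by have := bg_col bigr exa; rewrite (negbTE xX) => /esym/negbFE.
have va : ~~ e v a by apply/negP => /(bg_col bigr); rewrite vX aX.
have Ep : p = rcons A2 a ++ R by move: E; rewrite EA cat_rcons => -[].
have [hv|hv] := boolP (has (e v) (x :: A2)); last first.
  have pA : path e x (rcons A2 a) by move: pp; rewrite Ep cat_path => /andP[].
  have uA : uniq (x :: rcons A2 a) by move: up; rewrite Ep -cat_cons cat_uniq => /and3P[].
  have lA : last x (rcons A2 a) = a by rewrite last_rcons.
  have nbx : {subset nb e x <= x :: rcons A2 a}.
    move=> y ynb; have := sx y ynb; rewrite Ep -cat_cons mem_cat => /orP[//|yR].
    by case/hasP: nR; exists y => //; move: ynb; rewrite inE.
  have nv : {in x :: rcons A2 a, forall y, ~~ e v y}.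
    move=> y; rewrite inE mem_rcons inE => /or3P[/eqP->|/eqP->//|yA].
      by apply: contra hv => ev; rewrite /= ev.
    by apply: contra hv => ev; apply/hasP; exists y => //; rewrite inE yA orbT.
  pose A := [set y in x :: rcons A2 a].
  have Elast : v = last a R by rewrite /v Ep last_cat last_rcons.
  have pR : path e a R by move: pp; rewrite Ep cat_path last_rcons => /andP[].
  have dAR : {in R, forall y, y \notin A}.
    move=> y yR; rewrite inE; move: up; rewrite Ep -cat_cons cat_uniq => /and3P[_ /hasPn h _].
    exact: h.
  have uR : uniq (a :: R).
    by move: up; rewrite Ep cat_rcons -cat_cons cat_uniq => /and3P[].
  pose z := last x A2.
  have ezr : e z a by move: pA; rewrite rcons_path => /andP[].
  have zA2 : z \in x :: A2 by exact: mem_last.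
  have za : z != a.
    move: uA; rewrite -rcons_cons rcons_uniq => /andP[aA _].
    by apply: contraNneq aA => <-.
  (* The vine starts from the last edge of the initial segment, as an ear with empty interior. *)
  have earI : ear e A a z [::] a.
    split=> //=; rewrite ?ezr ?inE ?za ?eqxx ?orbT //.
    split; last by rewrite mem_rcons mem_head orbT.
    by move: zA2; rewrite mem_rcons !inE => /orP[->|->]; rewrite ?orbT.
  have hvR : has (e (last a R)) (a :: R).
    rewrite -Elast; apply/hasP.
    have [y0 [l El]] : exists y0 l, p = rcons l y0.
      by case/lastP: (p) pn => // l y0 _; exists y0, l.
    pose y := last x l.
    have evy : e v y.
      move: pp; rewrite (bg_sym bigr) /v El last_rcons rcons_path => /andP[_ //].
    have : y \in x :: p by apply: sv; rewrite inE.
    move=> yp; exists y => //; move: yp; rewrite Ep -cat_cons mem_cat => /orP[/nv/negP/(_ evy)//|yR].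
    by rewrite inE yR orbT.
  have aL : a \in z :: rcons [::] a by rewrite !inE eqxx orbT.
  have RL : {in R, forall y, y \notin z :: rcons [::] a}.
    move=> y yR; have := dAR y yR; apply: contra; rewrite !inE => /orP[/eqP->|/eqP->].
      by move: zA2; rewrite inE mem_rcons inE => /orP[->|->]; rewrite ?orbT.
    by rewrite mem_rcons inE eqxx orbT.
  have [y1 [J [y2 [earJ covJ]]]] := vine pR uR earI aL (fun _ => erefl) dAR RL hvR.
  apply: (close_ear pA uA lA exa xX vX nbx nv earJ).
  move=> y; rewrite inE => evy; apply: covJ; last by rewrite -Elast.
  have : y \in x :: p by apply: sv; rewrite inE.
  rewrite Ep -cat_cons mem_cat => /orP[/nv/negP/(_ evy)//|yR].
  by rewrite inE yR orbT.
have [B1 [j [B2 [EB evj nB2]]]] := has_split_last hv.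
have hx2 : has (e x) (rcons B2 a) by rewrite has_rcons exa.
have [M [i [N [EN exi nM]]]] := has_split_first hx2.
have nMv : ~~ has (e v) M.
  case/lastP: N EN => [|N y].
    by rewrite cats1 => /rcons_inj[<- _].
  rewrite -rcons_cons -rcons_cat => /rcons_inj[EB2 _].
  by apply: contra nB2; rewrite EB2 has_cat => ->.
pose L1 := behead (rcons B1 j); pose N' := N ++ R.
have EL : rcons B1 j = x :: L1.
  by rewrite /L1; case: (B1) EB => [|y l] /= [-> _].
have lL : last x L1 = j by have := last_rcons x B1 j; rewrite EL.
have Exp : x :: p = (x :: L1) ++ M ++ i :: N'.
  by rewrite Ep -cat_cons -rcons_cons EB rcons_cat rcons_cons EN -cat_rcons EL /N' -!catA.
have Ep' : p = L1 ++ M ++ i :: N' by case: Exp.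
have [pL pN] : path e x L1 /\ path e i N'.
  by move: pp; rewrite Ep' cat_path => /andP[pL]; rewrite cat_path /= => /and3P[].
have lN : last i N' = v by rewrite /v Ep' (last_cat x L1) (last_cat _ M).
clearbody N' L1.
have uw : uniq (x :: L1 ++ i :: N').
  move: up; rewrite Exp; apply: subseq_uniq.
  by rewrite -[X in subseq X _]/((x :: L1) ++ [::] ++ i :: N') !cat_subseq ?sub0seq.
have evj' : e (last i N') (last x L1) by rewrite lN lL.
have [s cs ps] := cross_ucycle bigr uw pL pN evj' exi.
exists s => //.
have := cycle_count bigr (ucycle_cycle cs).
have -> : count [predC X] s = count [predC X] (x :: L1) + count [predC X] (i :: N').
  by rewrite (permP ps) -count_cat.
rewrite -(count_predC [in X] s) => ->; rewrite (permP ps) -cat_cons count_cat.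
have jX : j \notin X by have := bg_col bigr evj; rewrite vX => <-.
have nc1 s1 s2 b c : x :: L1 = s1 ++ b :: c :: s2 -> ~~ (e v b && e x c).
  by move=> E1; apply: (nc s1 (s2 ++ M ++ i :: N')); rewrite Exp E1 -catA.
have nc2 s1 s2 b c : i :: N' = s1 ++ b :: c :: s2 -> ~~ (e v b && e x c).
  by move=> E1; apply: (nc ((x :: L1) ++ M ++ s1) s2); rewrite Exp E1 -!catA.
have H1 := noncross_count bigr pL xX vX nc1.
have H2 := noncross_count bigr pN xX vX nc2.
have dx : deg e x = count (e x) L1 + (count (e x) N').+1.
  rewrite (deg_count up sx) Exp !count_cat.
  have -> : count (e x) M = 0 by apply/eqP; rewrite -leqn0 leqNgt -has_count.
  by rewrite add0n /= (bg_irr bigr) exi add0n add1n.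
have dv : deg e v = (count (e v) (belast x L1)).+1 + count (e v) (belast i N').
  rewrite (deg_count up sv) Exp !count_cat.
  have -> : count (e v) M = 0 by apply/eqP; rewrite -leqn0 leqNgt -has_count.
  rewrite add0n !lastI -!cats1 !count_cat /= lL lN evj (bg_irr bigr); clear; lia.
have c1 : count [predC X] (x :: L1) = (count [predC X] (belast x L1)).+1.
  by rewrite lastI -cats1 count_cat /= lL jX addn1.
have c2 : count [predC X] (i :: N') = count [predC X] (belast i N').
  by rewrite lastI -cats1 count_cat /= lN vX /= !addn0.
(* The two noncrossing counts miss the neighbours [i] and [j], which add two to the degree sum,
   while [j] adds one to the vertices outside [X]. *)
rewrite dx dv c1 c2; move: H1 H2; clear.
move: (count [predC X] _) (count [predC X] _) => S1 S2.
move: (count _ (belast x L1)) (count _ L1) (count _ (belast i N')) (count _ N') => n1 n2 n3 n4.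
by lia.
Qed.

End Circumference.

(** * Detours around a longest cycle *)

Lemma next_cat_cons (T : eqType) (s1 s2 : seq T) z n :
  uniq (s1 ++ z :: n :: s2) -> next (s1 ++ z :: n :: s2) z = n.
Proof.
move=> us; rewrite next_nth mem_cat mem_head orbT.
have iz : index z (s1 ++ z :: n :: s2) = size s1.
  rewrite index_cat /= eqxx addn0.
  by move: us; rewrite cat_uniq => /and3P[_ /hasPn/(_ z (mem_head _ _)) /= /negbTE ->].
case: s1 us iz => [|y s1] us iz; rewrite /= in iz *; first by rewrite iz.
by rewrite iz nth_cat ltnNge leqnSn /= subSnn.
Qed.

Lemma iter_next (T : eqType) (z : T) s d :
  uniq (z :: s) -> d <= size s -> iter d (next (z :: s)) z = nth z (z :: s) d.
Proof.
move=> us; elim: d => // d IH ltd; rewrite iterS IH ?(ltnW ltd) // next_nth.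
by rewrite mem_nth ?index_uniq //= ltnS ltnW.
Qed.

Section Cycles.
Variables (T : finType) (e : rel T) (X : {set T}).
Hypothesis bigr : bigraph e X.

Lemma ucycle_rot (s : seq T) z : ucycle e s -> z \in s ->
  exists s', [/\ ucycle e (z :: s'), perm_eq (z :: s') s & next (z :: s') =1 next s].
Proof.
move=> cs zs; have [i s' E] := rot_to zs.
exists s'; rewrite -E; split.
- by rewrite rot_ucycle.
- by rewrite perm_rot.
- by apply: next_rot; case/andP: cs.
Qed.

Lemma next_edge (s : seq T) z : ucycle e s -> z \in s -> e z (next s z).
Proof. by case/andP=> cs _ zs; exact: next_cycle cs zs. Qed.

Lemma iter_next_mem (s : seq T) z d : z \in s -> iter d (next s) z \in s.
Proof. by move=> zs; elim: d => //= d IH; rewrite mem_next. Qed.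

Lemma iter_next_col (s : seq T) z d : ucycle e s -> z \in s ->
  (iter d (next s) z \in X) = (z \in X) (+) odd d.
Proof.
move=> cs zs; elim: d => [|d IH] /=; first by rewrite addbF.
have := bg_col bigr (next_edge cs (iter_next_mem d zs)); rewrite IH.
by case: (next s _ \in X); case: (z \in X); case: (odd d).
Qed.

Lemma iter_next_onto (s : seq T) z y : ucycle e s -> z \in s -> y \in s ->
  exists d, y = iter d (next s) z.
Proof.
move=> cs zs ys; have [s' [cs' ps nx]] := ucycle_rot cs zs.
exists (index y (z :: s')); rewrite -(eq_iter nx) iter_next.
- by rewrite nth_index // (perm_mem ps).
- by case/andP: cs'.
- by rewrite -ltnS -[(size s').+1]/(size (z :: s')) index_mem (perm_mem ps).
Qed.

(** The double successor permutes [C] in a single orbit, so a nonempty set closed under it is all of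
    [C]. Until then every round gains a vertex. *)
Lemma cyclic_growth (s : seq T) (C S : {set T}) (b : bool) i :
  ucycle e s -> C = [set z in s | (z \in X) == b] -> S \subset C -> S != set0 ->
  exists U : {set T}, [/\ U \subset C, S \subset U, #|S| + i <= #|U| \/ U = C &
    {in U, forall z, exists2 z0, z0 \in S & exists2 j, j <= i & z = iter j.*2 (next s) z0}].
Proof.
move=> cs CE SC S0; elim: i => [|i [U [UC SU grow reach]]].
  exists S; split=> //; first by left; rewrite addn0.
  by move=> z zS; exists z => //; exists 0.
pose g z := next s (next s z).
have gC z : z \in C -> g z \in C.
  rewrite CE !inE => /andP[zs zb].
  by rewrite -[g z]/(iter 2 (next s) z) iter_next_mem // iter_next_col //= addbF.
have [sub|nsub] := boolP (g @: U \subset U).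
  exists U; split=> //; last by move=> z /reach[z0 z0S [j ji ->]]; exists z0 => //; exists j => //; exact: leqW.
  right; apply/eqP; rewrite eqEsubset UC /=; apply/subsetP => y yC.
  have [z zS] := set0Pn _ S0.
  have zU j : iter j.*2 (next s) z \in U.
    elim: j => [|j IH]; first exact: (subsetP SU).
    by rewrite doubleS; apply: (subsetP sub); apply/imsetP; exists (iter j.*2 (next s) z).
  have zC := subsetP SC z zS.
  move: yC zC; rewrite CE !inE => /andP[ys yb] /andP[zs zb].
  have [d Ed] := iter_next_onto cs zs ys.
  have od : ~~ odd d.
    move: yb; rewrite Ed iter_next_col // (eqP zb).
    by case: (odd d); case: (b).
  by rewrite Ed -(odd_double_half d) (negbTE od) add0n.
exists (U :|: g @: U); split.
- by rewrite subUset UC; apply/subsetP => y /imsetP[z zU ->]; apply: gC; exact: (subsetP UC).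
- by rewrite subsetU ?SU.
- case: grow => [grow|UE].
    left; rewrite addnS; apply: leq_ltn_trans grow _; apply: proper_card.
    by rewrite properE subsetUl subUset subxx.
  move: nsub; rewrite UE => /negP[]; apply/subsetP => y /imsetP[z zU ->].
  exact: gC.
- move=> z; rewrite inE => /orP[/reach[z0 z0S [j ji ->]]|/imsetP[y /reach[z0 z0S [j ji ->]] ->]].
    by exists z0 => //; exists j => //; exact: leqW.
  by exists z0 => //; exists j.+1.
Qed.

(** The path replaces the [d.-1] vertices strictly between [z] and the vertex [d] steps further
    on. *)
Lemma detour (s : seq T) p0 P z d :
  ucycle e s -> path e p0 P -> uniq (p0 :: P) -> {in p0 :: P, forall y, y \notin s} ->
  z \in s -> e p0 z -> 0 < d < size s -> e (last p0 P) (iter d (next s) z) ->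
  exists2 s', ucycle e s' & size s + size (p0 :: P) = size s' + d.-1.
Proof.
move=> cs pP uP offP zs ez /andP[d0 ds] ed.
have [w [cw pw nx]] := ucycle_rot cs zs.
have [cw' uw] := andP cw.
have sw : size s = (size w).+1 by rewrite -(perm_size pw).
have dw' : d <= size w by rewrite -ltnS -sw.
rewrite -(eq_iter nx) iter_next // in ed.
case: d d0 ds dw' ed => // d _ ds dw /=; set z' := nth z w d => ed.
have Ew : w = take d w ++ z' :: drop d.+1 w by rewrite -drop_nth ?cat_take_drop.
exists (z :: (p0 :: P) ++ z' :: drop d.+1 w); last first.
  rewrite sw /= size_cat /= size_drop; move: dw; clear.
  by move: (size w) (size P) => k m; lia.
have sub : subseq (z :: z' :: drop d.+1 w) (z :: w).
  by rewrite {2}Ew /= eqxx -[X in subseq X _]/([::] ++ z' :: drop d.+1 w) cat_subseq ?sub0seq.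
apply/andP; split.
  move: cw'; rewrite {1}Ew /cycle rcons_cat cat_path rcons_cons /= => /and3P[_ _ pd].
  by rewrite rcons_cat rcons_cons cat_path /= (bg_sym bigr) ez pP ed.
have /andP[zd ud] : (z \notin z' :: drop d.+1 w) && uniq (z' :: drop d.+1 w).
  exact: (subseq_uniq sub uw).
have zP : z \notin p0 :: P by apply: contraL zs => /offP.
have u1 : uniq (z :: p0 :: P) by rewrite cons_uniq zP uP.
rewrite -cat_cons cat_uniq u1 ud andbT andTb; apply/hasPn => y yd; rewrite /= in_cons negb_or; apply/andP; split.
  by apply: contraNneq zd => <-.
apply: contraL (mem_subseq sub (x := y) _) => [/offP|]; last by rewrite inE yd orbT.
by rewrite (perm_mem pw).
Qed.

(* An attachment of the last vertex less than [size (p0 :: P)] steps behind one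
   of [p0] lets the cycle be lengthened through the path, so the successive
   shifts of the first attachment set avoid the second one. *)
Lemma detour_count (s : seq T) c p0 P :
  ucycle e s -> (forall s', ucycle e s' -> size s' <= size s) -> size s = c.*2 ->
  path e p0 P -> uniq (p0 :: P) -> {in p0 :: P, forall y, y \notin s} ->
  0 < size P -> size P < c.*2 ->
  (exists2 z, z \in s & e p0 z) -> (exists2 z, z \in s & e (last p0 P) z) ->
  #|nb e p0 :&: [set z in s]| + #|nb e (last p0 P) :&: [set z in s]| + (size P).+1./2 <= c.+1.
Proof.
move=> cs mx sc pP uP offP P0 Pc [z0 z0s ez0] [z1 z1s ez1].
set N0 := nb e p0 :&: _; set N1 := nb e _ :&: _.
pose b := last p0 P \notin X.
pose C := [set z in s | (z \in X) == b].
have us : uniq s by case/andP: cs.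
have cardC : #|C| = c.
  have half B : B = X \/ B = ~: X -> #|[set z in s] :&: B| = c.
    move=> BE; rewrite card_count //; apply: double_inj; rewrite -sc.
    case: BE => ->; first by rewrite (cycle_size bigr (ucycle_cycle cs)).
    by rewrite (cycle_size (bigraphC bigr) (ucycle_cycle cs)).
  rewrite -(half (if b then X else ~: X)); last by case: (b); [left|right].
  by apply: eq_card => z; rewrite /C; case: (b); rewrite !inE ?eqb_id // eqbF_neg.
have N1C : N1 \subset C.
  apply/subsetP => z; rewrite !inE => /andP[ez ->] /=.
  by have := bg_col bigr ez; rewrite /b => ->; rewrite negbK.
(* A first shift by one or two, chosen by parity so that it lands in the class of the second
   attachment set. *)
pose d0 := (~~ odd (size P)).+1.
pose S := iter d0 (next s) @: N0.
have SC : S \subset C.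
  apply/subsetP => y /imsetP[z]; rewrite !inE => /andP[ez zs] ->.
  rewrite iter_next_mem // iter_next_col //= /b (path_col bigr pP) oddb.
  by have := bg_col bigr ez; case: (p0 \in X); case: (z \in X); case: (odd _).
have cardS : #|S| = #|N0|.
  have can d : cancel (iter d (next s)) (iter d (prev s)).
    by elim: d => // d IH z; rewrite iterSr iterS prev_next.
  exact: card_imset (can_inj (can d0)).
have S0 : S != set0.
  by rewrite -card_gt0 cardS card_gt0; apply/set0Pn; exists z0; rewrite !inE ez0.
(* With this many rounds the total shift is at most [size P], so a detour drops at most [size P - 1]
   vertices and gains [size P + 1]. *)
have [U [UC SU grow reach]] := cyclic_growth ((size P).+1./2).-1 cs erefl SC S0.
have dis : [disjoint U & N1].
  rewrite disjoint_subset; apply/subsetP => y /reach[y0 /imsetP[z zN ->] [j ji ->]].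
  move: zN; rewrite !inE => /andP[ez zs]; apply/negP => /andP[ey ys].
  rewrite -iterD in ey.
  have d_bd : 0 < j.*2 + d0 <= size P.
    by rewrite /d0; move: ji P0; clear; case: (boolP (odd _)) => /=; lia.
  have ds : 0 < j.*2 + d0 < size s.
    by case/andP: d_bd => -> h; rewrite sc (leq_ltn_trans h Pc).
  have [s' cs' ss'] := detour cs pP uP offP zs ez ds ey.
  have := mx s' cs'; move: ss' d_bd => /=; clear; lia.
case: grow => [grow|UE]; last first.
  have : z1 \in N1 by rewrite !inE ez1.
  move=> z1N; have z1C := subsetP N1C z1 z1N.
  by rewrite UE in dis; rewrite (disjointFl dis z1N) in z1C.
have : #|U| + #|N1| <= c.
  have /eqP <- : #|U :|: N1| == #|U| + #|N1| by rewrite (leq_card_setU U N1).2.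
  by rewrite -cardC; apply: subset_leq_card; rewrite subUset UC N1C.
move: grow P0; rewrite cardS; clear; lia.
Qed.

(* Two neighbours of [x] on the cycle whose successors are both neighbours of
   [y] allow rerouting through [x] and [y] without losing a vertex. *)
Lemma two_detours (s : seq T) c x y :
  ucycle e s -> (forall s', ucycle e s' -> size s' <= size s) -> size s = c.*2 ->
  x \in X -> y \notin X -> x \notin s -> y \notin s ->
  #|nb e x :&: [set z in s]| + #|nb e y :&: [set z in s]| <= c.+1.
Proof.
move=> cs mx sc xX yX xs ys.
set N0 := nb e x :&: _; set N1 := nb e _ :&: _.
have us : uniq s by case/andP: cs.
have cardC : #|[set z in s] :&: X| = c.
  by rewrite card_count //; apply: double_inj; rewrite -sc (cycle_size bigr (ucycle_cycle cs)).
pose S := next s @: N0.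
have cardS : #|S| = #|N0|.
  by apply: card_imset; apply: (can_inj (prev_next us)).
have SC : S \subset [set z in s] :&: X.
  apply/subsetP => z' /imsetP[z]; rewrite !inE => /andP[ez zs] ->.
  rewrite mem_next zs /=; have := bg_col bigr (next_edge cs zs); have := bg_col bigr ez.
  by rewrite xX; case: (z \in X); case: (next s z \in X).
have NC : N1 \subset [set z in s] :&: X.
  apply/subsetP => z; rewrite !inE => /andP[ez ->] /=.
  by have := bg_col bigr ez; rewrite (negbTE yX) => /esym/negbFE.
have : #|S :&: N1| <= 1.
  rewrite leqNgt; apply/negP => /card_gt1P[w1 [w2 []]].
  rewrite !in_setI => /andP[/imsetP[z1 z1N ->] n1N] /andP[/imsetP[z2 z2N ->] n2N] w12.
  move: z1N z2N n1N n2N; rewrite !inE => /andP[ez1 z1s] /andP[ez2 z2s] /andP[en1 _] /andP[en2 _].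
  have z12 : z1 != z2 by apply: contraNneq w12 => ->.
  have [w [cw pw nx]] := ucycle_rot cs z1s.
  have [cw' uw] := andP cw.
  have z2w : z2 \in w by move: z2s; rewrite -(perm_mem pw) inE eq_sym (negbTE z12).
  have [s1 [s2 Ew]] : exists s1 s2, w = s1 ++ z2 :: s2 by case/splitPr: z2w => s1 s2; exists s1, s2.
  have z1X : z1 \notin X by have := bg_col bigr ez1; rewrite xX => /esym.
  have z2X : z2 \notin X by have := bg_col bigr ez2; rewrite xX => /esym.
  have nX u : e y u -> u \in X by move=> /(bg_col bigr); rewrite (negbTE yX) => /esym/negbFE.
  rewrite -nx in en1; rewrite -nx in en2.
  case: s1 Ew => [|n1 A] Ew.
    have E1 : next (z1 :: w) z1 = z2.
      by rewrite Ew; apply: (next_cat_cons (s1 := [::])); move: uw; rewrite Ew.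
    by move: (nX _ en1); rewrite E1 (negbTE z2X).
  case: s2 Ew => [|n2 B] Ew.
    have E2 : next (z1 :: w) z2 = z1.
      have z2n : z2 \notin z1 :: n1 :: A.
        by move: uw; rewrite Ew -cat_cons cats1 rcons_uniq => /andP[].
      rewrite next_nth inE z2w orbT Ew -cat_cons index_cat (negbTE z2n) /= eqxx addn0.
      by rewrite nth_default // size_cat /= addn1.
    by move: (nX _ en2); rewrite E2 (negbTE z1X).
  have En1 : next (z1 :: w) z1 = n1.
    by rewrite Ew; apply: (next_cat_cons (s1 := [::])); move: uw; rewrite Ew.
  have En2 : next (z1 :: w) z2 = n2.
    by rewrite Ew; apply: (next_cat_cons (s1 := z1 :: n1 :: A)); move: uw; rewrite Ew.
  rewrite En1 in en1; rewrite En2 in en2.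
  (* Both cycle edges behind [z1] and [z2] are cut. [x] joins [z1] to [z2] and [y] joins their
     successors, with one arc reversed, so no vertex is lost. *)
  pose s' := x :: z1 :: rev (n2 :: B) ++ y :: n1 :: rcons A z2.
  suff cs' : ucycle e s'.
    have := mx s' cs'; rewrite -(perm_size pw) Ew /s' /= !size_cat size_rev /= size_rcons.
    by move: (size A) (size B); clear => k m; lia.
  apply/andP; split.
    have [pA eA pB eB] : [/\ path e n1 A, e (last n1 A) z2, path e n2 B & e (last n2 B) z1].
      move: cw'; rewrite Ew /= rcons_cat /= cat_path /= rcons_path.
      by move=> /and5P[_ ? ? _ /andP[]].
    rewrite /s' rev_cons_last /= ez1 (bg_sym bigr) eB rcons_cat /=.
    rewrite cat_path (rev_pathS bigr) //= last_rev_belast (bg_sym bigr) en2 en1.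
    by rewrite !rcons_path pA eA last_rcons (bg_sym bigr) ez2.
  rewrite (perm_uniq (s2 := x :: y :: z1 :: w)).
    have xy : x != y by apply: contraTneq xX => ->.
    rewrite -!(perm_mem pw) in xs ys.
    by rewrite 2!cons_uniq uw in_cons negb_or xy xs ys.
  rewrite /s' Ew; apply/permP => f; rewrite /= !count_cat count_rev /= -cats1 !count_cat /=.
  by clear; lia.
have := cardsU S N1; have := subset_leq_card (_ : S :|: N1 \subset [set z in s] :&: X).
rewrite subUset SC NC cardC cardS => /(_ isT).
have := subset_leq_card (subsetIl S N1); rewrite cardS.
by clear; lia.
Qed.

End Cycles.

(** * Dense Hamiltonian graphs *)

Section Bondy.
Variables (T : finType) (e : rel T) (X : {set T}).
Hypothesis bigr : bigraph e X.

(* Bondy's argument: for consecutive [x], [y] on a Hamiltonian cycle, pair the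
   possible chords at [y] and at [x] so that each pair closes a cycle of length
   [2l]; the pairing is a rotation modulo [c - 1]. *)
Lemma chord_pairing c l y s :
  ucycle e (y :: s) -> (size s).+1 = c.*2 -> (forall v, v \in y :: s) ->
  y \notin X -> c < (deg e (last y s) + deg e y).-1 -> 1 < l <= c ->
  exists2 s', ucycle e s' & size s' = l.*2.
Proof.
move=> cs ss full yX hdeg /andP[l1 lc].
have [cys us] := andP cs.
set x := last y s in hdeg *.
have ps : path e y s by move: cys; rewrite /= rcons_path => /andP[].
have exy : e x y by move: cys; rewrite /= rcons_path => /andP[].
pose f i := nth y (y :: s) i.
have fX i : i < c.*2 -> (f i \in X) = odd i.
  move=> ic; have : path e y (take i s) by exact: take_path.
  have fi : f i = last y (take i s).
    by case: i ic => [|i] ic; [rewrite take0|rewrite (take_nth y) ?last_rcons //= -ltnS ss].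
  move=> /(path_col bigr); rewrite -fi (negbTE yX) size_take_min.
  by have /minn_idPl -> : i <= size s by rewrite -ltnS ss.
have fidx z : exists2 i, i < c.*2 & z = f i.
  exists (index z (y :: s)); first by rewrite -ss -[(size s).+1]/(size (y :: s)) index_mem.
  by rewrite /f nth_index.
have fx : f (c.*2).-1 = x by have := nth_last y (y :: s); rewrite /f -ss.
have c2 : 1 < c by apply: leq_trans l1 lc.
(* The cycle edge between [x] and [y] is left out of [A] and [B]. The degree sum is at least c + 2,
   so these sets have at least c elements together, among c - 1 positions. *)
pose A := [set a : 'I_(c.-1) | e y (f a.*2.+1)].
pose B := [set b : 'I_(c.-1) | e x (f b.*2.+2)].
have xX : x \in X by rewrite -fx fX; [move: c2; clear; lia | move: c2; clear; lia].
have dA : deg e y <= #|A|.+1.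
  rewrite /deg; apply: (@leq_trans #|x |: [set f a.*2.+1 | a : 'I_(c.-1) in A]|).
    apply: subset_leq_card; apply/subsetP => z; rewrite !inE => eyz.
    have [i ic Ez] := fidx z.
    have oi : odd i by rewrite -(fX i ic) -Ez; have := bg_col bigr eyz; rewrite (negbTE yX) => /esym/negbFE.
    have Ei : i = (i./2).*2.+1 by rewrite -{1}(odd_double_half i) oi.
    have [lt|ge] := ltnP i./2 c.-1.
      apply/orP; right; apply/imsetP; exists (Ordinal lt); last by rewrite /= -Ei.
      by rewrite inE /= -Ei -Ez.
    apply/orP; left; rewrite Ez -fx; apply/eqP; congr f.
    by move: ic oi ge c2; clear; lia.
  rewrite cardsU1; apply: leq_add (leq_b1 _) (leq_imset_card _ _).
have dB : deg e x <= #|B|.+1.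
  rewrite /deg; apply: (@leq_trans #|y |: [set f b.*2.+2 | b : 'I_(c.-1) in B]|).
    apply: subset_leq_card; apply/subsetP => z; rewrite !inE => exz.
    have [i ic Ez] := fidx z.
    have oi : ~~ odd i by rewrite -(fX i ic) -Ez; have := bg_col bigr exz; rewrite xX => /esym.
    case: i ic Ez oi => [|i] ic Ez oi; first by rewrite Ez eqxx.
    have lt : i./2 < c.-1 by move: ic oi c2; clear; lia.
    have Ei : i.+1 = (i./2).*2.+2.
      by move: oi; rewrite /= negbK => oi; rewrite -{1}(odd_double_half i) oi.
    apply/orP; right; apply/imsetP; exists (Ordinal lt); last by rewrite /= -Ei.
    by rewrite inE /= -Ei -Ez.
  rewrite cardsU1; apply: leq_add (leq_b1 _) (leq_imset_card _ _).
have cm0 : 0 < c.-1 by move: c2; clear; lia.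
pose phi (a : 'I_(c.-1)) := Ordinal (ltn_pmod (a + (l - 2)) cm0).
have phi_inj : injective phi.
  move=> a b /(congr1 val)/= /eqP; rewrite eqn_modDr !modn_small // => /eqP ab.
  exact: val_inj.
have [b] : exists b, b \in (phi @: A) :&: B.
  apply/set0Pn; rewrite -card_gt0.
  have := cardsUI (phi @: A) B; rewrite card_imset //.
  have := max_card (mem ((phi @: A) :|: B)); rewrite card_ord.
  move: dA dB hdeg; clear.
  move: #|_ :|: _| #|_ :&: _| #|A| #|B| (deg e x) (deg e y) => *; lia.
rewrite inE => /andP[/imsetP[a aA Eb] bB].
move: aA bB; rewrite !inE => eya exb.
have Evb : (b : nat) = (a + (l - 2)) %% c.-1 by rewrite Eb.
have ac := ltn_ord a.
(* Without wrap-around the cycle is [y], the stretch from [f (2a+1)] to [f (2b+2)], and [x]: 2 + 2(l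
   - 1) vertices. With wrap-around a - b = c + 1 - l, and the crossing cycle omits what lies
   strictly between [f (2b+2)] and [f (2a+1)], keeping 2c + 2 - 2(a - b) = 2l vertices. *)
have [small|big] := ltnP (a + (l - 2)) c.-1.
  rewrite modn_small // in Evb.
  pose P := take a.*2 s; pose S := take (l.-1).*2 (drop a.*2 s).
  pose Q := drop (l.-1).*2 (drop a.*2 s).
  have szS : size S = (l.-1).*2.
    by rewrite size_takel // size_drop; move: ss small l1; clear; lia.
  have Es : s = P ++ S ++ Q by rewrite !cat_take_drop.
  have szP : size P = a.*2 by rewrite size_takel //; move: ss ac; clear; lia.
  have szQ : 0 < size Q by rewrite !size_drop; move: ss small l1; clear; lia.
  have [h [S' ES]] : exists h S', S = h :: S'.
    by case: (S) szS => [|h S'] sz; [move: sz l1; clear => /=; lia | exists h, S'].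
  have [Q' EQ] : exists Q', Q = rcons Q' x.
    rewrite /x Es !last_cat; case/lastP: (Q) szQ => // Q' q _.
    by exists Q'; rewrite last_rcons.
  have Eh : h = f a.*2.+1 by rewrite /f /= Es nth_cat szP ltnn subnn ES.
  have El : last h S' = f b.*2.+2.
    rewrite -[last h S']/(last h (h :: S')) -ES -nth_last szS /f /= Es nth_cat szP.
    have -> : b.*2.+1 < a.*2 = false by rewrite Evb; move: l1; clear; lia.
    rewrite nth_cat szS; have -> : b.*2.+1 - a.*2 = ((l.-1).*2).-1 by rewrite Evb; move: l1; clear; lia.
    have lt : ((l.-1).*2).-1 < (l.-1).*2 by move: l1; clear; lia.
    by rewrite lt; apply: set_nth_default; rewrite szS.
  exists (y :: rcons (h :: S') x); last by rewrite /= size_rcons; move: szS l1; rewrite ES /=; clear; lia.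
  apply/andP; split.
    have pS : path e h S'.
      by move: ps; rewrite Es cat_path => /andP[_]; rewrite cat_path ES /= => /andP[/andP[]].
    by rewrite /= !rcons_path last_rcons Eh eya -Eh pS El (bg_sym bigr) exb exy.
  have sub : subseq (rcons (h :: S') x) s.
    rewrite Es ES EQ -!cats1.
    exact: (cat_subseq (sub0seq P) (cat_subseq (subseq_refl (h :: S'))
      (cat_subseq (sub0seq Q') (subseq_refl [:: x])))).
  by apply: subseq_uniq us; rewrite [subseq _ _]/= eqxx.
have Evb' : (b : nat) = a + (l - 2) - c.-1.
  rewrite Evb -{1}(subnK big) modnDr modn_small //.
  by move: ac l1 lc; clear; lia.
pose P := take b.*2.+2 s.
have szP : size P = b.*2.+2 by rewrite size_takel //; move: ss ac big Evb' l1 lc; clear; lia.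
have [h [R ER]] : exists h R, drop a.*2 s = h :: R.
  exists (nth y s a.*2), (drop a.*2.+1 s); apply: drop_nth.
  by move: ss ac; clear; lia.
have szR : (size R).+1 = size s - a.*2 by rewrite -size_drop ER.
have Eh : h = f a.*2.+1.
  by rewrite /f /= -[a.*2]addn0 -nth_drop ER.
have lR : last h R = x.
  by rewrite /x -(cat_take_drop a.*2 s) last_cat ER.
have lP : last y P = f b.*2.+2.
  by rewrite -nth_last szP /f /= nth_take.
have sub : subseq (P ++ h :: R) s.
  rewrite -ER -{2}(cat_take_drop a.*2 s) cat_subseq //.
  have -> : P = take b.*2.+2 (take a.*2 s).
    by rewrite take_takel //; move: ac big Evb' l1 lc; clear; lia.
  exact: take_subseq.
have uw : uniq (y :: P ++ h :: R).
  by apply: subseq_uniq us; rewrite /= eqxx.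
have pP : path e y P by exact: take_path.
have pR : path e h R.
  by move: ps; rewrite -(cat_take_drop a.*2 s) cat_path ER /= => /and3P[].
have ex' : e (last h R) (last y P) by rewrite lR lP.
have ey' : e y h by rewrite Eh.
have [s' cs' ps'] := cross_ucycle bigr uw pP pR ex' ey'.
exists s' => //; rewrite (perm_size ps') /= size_cat szP /= szR.
by move: ss ac big Evb' l1 lc; clear; lia.
Qed.

(** Averaging: summing [deg x + deg (next x)] over [X] counts each edge twice, so some consecutive
    pair has degree sum above c + 1. *)
Lemma dense_hamiltonian_pancyclic c l s :
  ucycle e s -> size s = c.*2 -> (forall v, v \in s) ->
  c * c.+1 < (nedges e X).*2 -> 1 < l <= c ->
  exists2 s', ucycle e s' & size s' = l.*2.
Proof.
move=> cs ss full dense lb.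
have [cys us] := andP cs.
have cX : #|X| = c.
  rewrite -[X]setIT; have -> : [set: T] = [set z in s] by apply/setP => z; rewrite !inE full.
  rewrite setIC card_count //; apply: double_inj.
  by rewrite -ss (cycle_size bigr cys).
have [x xX dx] : exists2 x, x \in X & c.+1 < deg e x + deg e (next s x).
  apply/exists_inP; apply: contraLR dense => /exists_inPn H; rewrite -leqNgt.
  have -> : (nedges e X).*2 = \sum_(x in X) (deg e x + deg e (next s x)).
    rewrite big_split /= -(nedges_sum e X) -addnn; congr addn.
    rewrite -(nedgesC bigr) (nedges_sum e) (reindex_inj (can_inj (prev_next us))) /=.
    apply: eq_bigl => z; rewrite inE.
    by have := bg_col bigr (next_edge cs (full z)) => ->.
  rewrite -{1}cX -sum_nat_const; apply: leq_sum => x xX.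
  by rewrite leqNgt H.
pose y := next s x.
have ys : y \in s by exact: full.
have [s' [cs' ps' nx]] := ucycle_rot cs ys.
have us' : uniq (y :: s') by case/andP: cs'.
have lx : last y s' = x.
  have := cycle_next us'; rewrite /cycle rcons_path => /andP[_ /eqP].
  by rewrite nx; exact: (can_inj (prev_next us)).
apply: (chord_pairing (c := c) cs') => //.
- by rewrite -ss -(perm_size ps').
- by move=> v; rewrite (perm_mem ps').
- by have := bg_col bigr (next_edge cs (full x)); rewrite xX => /esym.
- by rewrite lx; move: dx; rewrite -/y; clear; lia.
Qed.
End Bondy.

(** * Removing a pair off a longest cycle *)

Section Induced.
Variables (T : finType) (e : rel T) (X S : {set T}).
Hypothesis bigr : bigraph e X.

Definition ind_rel : rel {v : T | v \in S} := relpre val e.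
Definition ind_set (Y : {set T}) : {set {v : T | v \in S}} := [set v | val v \in Y].
(** Edges of the induced subgraph kept as pairs of the ambient type, so that counts for different
    [S] can be compared and added. *)
Definition edges_in : {set T * T} :=
  [set p | [&& p.1 \in X, p.1 \in S, p.2 \in S & e p.1 p.2]].

Lemma ind_bigraph : bigraph ind_rel (ind_set X).
Proof.
split=> [u v|u v /(bg_col bigr)]; first exact: bg_sym bigr _ _.
by rewrite !inE.
Qed.

Lemma card_val_imset (A : {set {v : T | v \in S}}) (B : {set T}) :
  (forall v, (v \in A) = (val v \in B)) -> #|A| = #|B :&: S|.
Proof.
move=> AB; rewrite -(card_imset _ val_inj); apply: eq_card => z; rewrite inE.
apply/imsetP/andP => [[v vA ->]|[zB zS]]; first by rewrite -AB vA (valP v).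
by exists (exist _ z zS); rewrite ?AB.
Qed.

Lemma ind_deg v : deg ind_rel v = #|nb e (val v) :&: S|.
Proof. by apply: card_val_imset => u; rewrite !inE. Qed.

Lemma ind_card Y : #|ind_set Y| = #|Y :&: S|.
Proof. by apply: card_val_imset => u; rewrite !inE. Qed.

Lemma ind_cardC Y : #|~: ind_set Y| = #|~: Y :&: S|.
Proof. by apply: card_val_imset => u; rewrite !inE. Qed.

Lemma ind_path v p : path ind_rel v p = path e (val v) (map val p).
Proof. by rewrite path_map. Qed.

Lemma ind_ucycle s : ucycle ind_rel s = ucycle e (map val s).
Proof.
rewrite /ucycle (map_inj_uniq val_inj); congr (_ && _).
by case: s => [|v s] //=; rewrite -map_rcons path_map.
Qed.

Lemma ind_lift s : {subset s <= S} -> exists s' : seq {v : T | v \in S}, map val s' = s.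
Proof.
elim: s => [|x s IH] sub; first by exists [::].
have [|s' <-] := IH; first by move=> y ys; apply: sub; rewrite inE ys orbT.
have xS : x \in S by apply: sub; rewrite mem_head.
by exists (exist _ x xS :: s').
Qed.

Lemma ind_nedges : nedges ind_rel (ind_set X) = #|edges_in|.
Proof.
have inj : injective (fun p : {v : T | v \in S} * {v : T | v \in S} => (val p.1, val p.2)).
  by move=> [a b] [c d] /= [/val_inj -> /val_inj ->].
rewrite /nedges -(card_imset _ inj); apply: eq_card => -[a b].
apply/imsetP/idP => [[[c d]]|]; rewrite !inE /=.
  by move=> /andP[cX ecd] [-> ->]; rewrite cX (valP c) (valP d).
move=> /and4P[aX aS bS eab]; exists (exist _ a aS, exist _ b bS) => //.
by rewrite !inE /= aX.
Qed.

End Induced.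

(** * The complement of a longest cycle when all pairs off it have large degree sum *)

Section RemovablePair.
Variables (T : finType) (e : rel T) (X : {set T}) (s : seq T) (c r : nat).
Hypothesis bigr : bigraph e X.
Hypothesis cs : ucycle e s.
Hypothesis mx : forall s', ucycle e s' -> size s' <= size s.
Hypothesis sc : size s = c.*2.
Hypothesis cardX : #|X| = c + r.
Hypothesis cardY : #|~: X| = c + r.
Hypothesis r0 : 0 < r.
Hypothesis rc : r <= c.

Let S := [set z | z \notin s].
Let dC v := #|nb e v :&: [set z in s]|.
Let dR v := #|nb e v :&: S|.

Lemma long_cycle_uniq : uniq s. Proof. by case/andP: cs. Qed.

Lemma deg_split v : deg e v = dC v + dR v.
Proof.
rewrite /deg -(cardsID [set z in s] (nb e v)); congr addn; apply: eq_card => z.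
by rewrite !inE andbC.
Qed.

Lemma half_cycle Y : Y = X \/ Y = ~: X -> #|[set z in s] :&: Y| = c.
Proof.
move=> YE; rewrite card_count ?long_cycle_uniq //; apply: double_inj; rewrite -sc.
case: YE => ->; first by rewrite (cycle_size bigr (ucycle_cycle cs)).
by rewrite (cycle_size (bigraphC bigr) (ucycle_cycle cs)).
Qed.

Lemma off_card Y : Y = X \/ Y = ~: X -> #|Y :&: S| = r.
Proof.
move=> YE; have := cardsID [set z in s] Y; rewrite setIC half_cycle //.
have -> : #|Y| = c + r by case: YE => ->.
have -> : Y :\: [set z in s] = Y :&: S by apply/setP => z; rewrite !inE andbC.
by clear; lia.
Qed.

Lemma nb_side v : exists2 Y, Y = X \/ Y = ~: X & nb e v \subset Y.
Proof.
have [vX|vX] := boolP (v \in X).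
  exists (~: X); first by right.
  by apply/subsetP => z; rewrite !inE => /(bg_col bigr); rewrite vX => <-.
exists X; first by left.
by apply/subsetP => z; rewrite !inE => /(bg_col bigr); rewrite (negbTE vX) => /esym/negbFE.
Qed.

Lemma dC_le v : dC v <= c.
Proof.
have [Y YE sub] := nb_side v; rewrite -(half_cycle YE) /dC [nb e v :&: _]setIC.
by apply: subset_leq_card; exact: setIS.
Qed.

Lemma dR_le v : dR v <= r.
Proof.
have [Y YE sub] := nb_side v; rewrite -(off_card YE) /dR.
by apply: subset_leq_card; exact: setSI.
Qed.

Lemma attached v : 0 < dC v -> exists2 z, z \in s & e v z.
Proof. by case/card_gt0P => z; rewrite !inE => /andP[ez zs]; exists z. Qed.

Lemma off_path_size p0 P : uniq (p0 :: P) -> {in p0 :: P, forall y, y \notin s} ->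
  size (p0 :: P) <= r.*2.
Proof.
move=> uP off; rewrite -(card_uniqP uP) -addnn.
rewrite -{1}(off_card (or_introl erefl)) -(off_card (or_intror erefl)).
have := cardsID X S; rewrite setIC [S :\: X]setDE [S :&: _]setIC => ->.
by apply: subset_leq_card; apply/subsetP => y /off; rewrite inE.
Qed.

Lemma detour_sum p0 P : path e p0 P -> uniq (p0 :: P) ->
  {in p0 :: P, forall y, y \notin s} -> 0 < size P -> 0 < dC p0 -> 0 < dC (last p0 P) ->
  dC p0 + dC (last p0 P) + (size P).+1./2 <= c.+1.
Proof.
move=> pP uP off P0 a0 a1.
apply: (detour_count bigr cs mx sc pP uP off P0); last 2 first.
- exact: attached.
- exact: attached.
have := off_path_size uP off; move: rc => /=; clear; lia.
Qed.

Lemma detour_sum_le p0 P : path e p0 P -> uniq (p0 :: P) ->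
  {in p0 :: P, forall y, y \notin s} -> 0 < size P -> dC p0 + dC (last p0 P) <= c.
Proof.
move=> pP uP off P0.
have [a0|a0] := posnP (dC p0); first by rewrite a0 dC_le.
have [a1|a1] := posnP (dC (last p0 P)); first by rewrite a1 addn0 dC_le.
have := detour_sum pP uP off P0 a0 a1; move: P0; clear; lia.
Qed.

Hypothesis heavy : forall x y, x \in X -> y \notin X -> x \notin s -> y \notin s ->
  c + r + e x y < deg e x + deg e y.

Lemma heavy_adj u v : e u v -> u \notin s -> v \notin s -> c + r + 1 < deg e u + deg e v.
Proof.
move=> euv us_ vs; have := bg_col bigr euv.
have [uX /esym vX|uX /esym/negbFE vX] := boolP (u \in X).
  by have := heavy uX vX us_ vs; rewrite euv.
by have := heavy vX uX vs us_; rewrite (bg_sym bigr) euv [deg e v + _]addnC.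
Qed.

Lemma adj_dR u v : e u v -> u \notin s -> v \notin s -> r.+1 < dR u + dR v.
Proof.
move=> euv us_ vs; have := heavy_adj euv us_ vs; rewrite !deg_split.
have uv : u != v by apply: contraTneq euv => ->; rewrite (bg_irr bigr).
have : dC u + dC v <= c.
  apply: (@detour_sum_le u [:: v]) => //=; rewrite ?euv ?inE ?uv //.
  by move=> y; rewrite !inE => /orP[/eqP->|/eqP->].
by clear; lia.
Qed.

Lemma nonadj_dR x y : x \in X -> y \notin X -> x \notin s -> y \notin s -> r <= dR x + dR y.
Proof.
move=> xX yX xs ys; have := heavy xX yX xs ys; rewrite !deg_split.
by have := two_detours bigr cs mx sc xX yX xs ys; rewrite -/(dC x) -/(dC y); clear; lia.
Qed.

(** Suppose the complement splits without edges across. An [X]-vertex on one side and a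
    non-[X]-vertex on the other together see at least r vertices off the cycle, and by [adj_dR] a
    side that contains an edge has more than r + 1 vertices. Two sides made up of r vertices from
    each class cannot satisfy all this. *)
Lemma off_connected : connected_graph (@ind_rel T e S).
Proof.
move=> V0; pose V := [set val v | v in V0] => V0n V0T.
have VS : V \subset S by apply/subsetP => y /imsetP[v _ ->]; exact: valP v.
suff [a [b [aV bV bS eab]]] : exists a b, [/\ a \in V, b \notin V, b \in S & e a b].
  move: aV eab => /imsetP[v vV ->] eab; exists v, (exist _ b bS); split=> //.
  by apply: contra bV => h; apply/imsetP; exists (exist _ b bS).
have [//|/existsPn none] := boolP [exists a, exists b, [&& a \in V, b \notin V, b \in S & e a b]].
  by case/existsP => a /existsP[b /and4P[aV bV bS eab]]; exists a, b.
have {}none a b : a \in V -> b \notin V -> b \in S -> e a b = false.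
  move=> aV bV bS; apply/negbTE; have := none a; rewrite negb_exists => /forallP/(_ b).
  by rewrite aV bV bS.
exfalso.
have Vn : V != set0 by rewrite /V; have /set0Pn[v vV] := V0n; apply/set0Pn; exists (val v); apply: imset_f.
pose W := S :\: V.
have Wn : W != set0.
  apply: contraNneq V0T => W0; apply/eqP/setP => v; rewrite inE.
  have : val v \notin W by rewrite W0 inE.
  rewrite inE (valP v) andbT negbK => /imsetP[u uV /val_inj ->]//.
have VW u v : u \in V -> v \in W -> e u v = false.
  by move=> uV; rewrite inE => /andP[vV vS]; apply: none.
have sS z : z \in S -> z \notin s by rewrite inE.
have nbV u : u \in V -> nb e u :&: S \subset V.
  move=> uV; apply/subsetP => z; rewrite inE inE => /andP[ez zS].
  by apply: contraT => zV; rewrite none in ez.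
have nbW u : u \in W -> nb e u :&: S \subset W.
  move=> uW; apply/subsetP => z; rewrite inE inE => /andP[ez zS].
  by rewrite inE zS andbT; apply: contraTN ez => zV; rewrite (bg_sym bigr) (VW z u).
have bound (Z : {set T}) u : nb e u :&: S \subset Z ->
    dR u <= if u \in X then #|Z :\: X| else #|Z :&: X|.
  move=> sub; have -> : (if u \in X then #|Z :\: X| else #|Z :&: X|) = #|Z :&: (if u \in X then ~: X else X)|.
    by case: ifP; rewrite ?setDE.
  apply: subset_leq_card; apply/subsetP => z zu; rewrite inE (subsetP sub) //=.
  move: zu; rewrite inE inE => /andP[/(bg_col bigr) + _].
  by case: (u \in X) => [/esym|/esym/negbFE //]; rewrite inE.
have WS : W \subset S by apply: subsetDl.
have adjZ (Z : {set T}) x : (forall u, u \in Z -> nb e u :&: S \subset Z) -> Z \subset S ->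
   x \in Z -> x \in X -> 0 < dR x -> r.+1 < #|Z :&: X| + #|Z :\: X|.
  move=> cl ZS xZ xX /card_gt0P[w]; rewrite inE inE => /andP[exw wS].
  have wZ : w \in Z by apply: (subsetP (cl x xZ)); rewrite inE inE exw.
  have wX : w \notin X by have := bg_col bigr exw; rewrite xX => /esym.
  have := adj_dR exw (sS _ (subsetP ZS _ xZ)) (sS _ wS).
  have := bound _ _ (cl _ xZ); have := bound _ _ (cl _ wZ); rewrite xX (negbTE wX).
  by clear; lia.
have card1 : #|V :&: X| + #|W :&: X| = r.
  rewrite -(off_card (or_introl erefl)) -(cardsID V (X :&: S)); congr addn; apply: eq_card => z.
    rewrite !inE andbC -andbA; congr andb; rewrite andb_idl // => /(subsetP VS).
    by rewrite inE.
  by rewrite !inE; case: (z \in V); case: (z \in X); case: (z \in s).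
have card2 : #|V :\: X| + #|W :\: X| = r.
  rewrite -(off_card (or_intror erefl)) -(cardsID V (~: X :&: S)); congr addn; apply: eq_card => z.
    rewrite !inE -andbA; congr andb; rewrite andb_idl // => /(subsetP VS).
    by rewrite inE.
  by rewrite !inE; case: (z \in V); case: (z \in X); case: (z \in s).
have pick (Z : {set T}) : Z != set0 -> 0 < #|Z :&: X| + #|Z :\: X|.
  by rewrite cardsID card_gt0.
have cross (Z Z' : {set T}) : (forall u, u \in Z -> nb e u :&: S \subset Z) ->
   (forall u, u \in Z' -> nb e u :&: S \subset Z') -> Z \subset S -> Z' \subset S ->
   0 < #|Z :&: X| -> 0 < #|Z' :\: X| ->
   r <= #|Z :\: X| + #|Z' :&: X| /\
   (#|Z' :&: X| < r -> r.+1 < #|Z :&: X| + #|Z :\: X|).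
  move=> cl cl' ZS ZS' /card_gt0P[x]; rewrite inE => /andP[xZ xX] /card_gt0P[y].
  rewrite inE => /andP[yX yZ].
  have h := nonadj_dR xX yX (sS _ (subsetP ZS _ xZ)) (sS _ (subsetP ZS' _ yZ)).
  have := bound _ _ (cl _ xZ); have := bound _ _ (cl' _ yZ); rewrite xX (negbTE yX) => b1 b2.
  split; first by move: h b1 b2; clear; lia.
  move=> lt; apply: (adjZ Z x) => //.
  by move: h b1 lt; clear; lia.
have := cross V W nbV nbW VS WS; have := cross W V nbW nbV WS VS.
have := pick V Vn; have := pick W Wn.
move: card1 card2.
move: #|V :&: X| #|V :\: X| #|W :&: X| #|W :\: X| => i j i' j' e1 e2 p1 p2 c1 c2.
by move: r0 e1 e2 p1 p2 c1 c2; clear; lia.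
Qed.

(** The ends of a saturated path in the complement send at most c edges to the cycle and at most r
    elsewhere, too few for a heavy pair. On a Hamiltonian cycle of the complement attached and
    unattached vertices alternate; removing an unattached one leaves a detour whose ends have at
    least c + 2 - r attachments each. *)
Lemma heavy_pairs_absurd : False.
Proof.
have bI := ind_bigraph S bigr.
have cI : #|ind_set S X| = #|~: ind_set S X|.
  by rewrite ind_cardC ind_card !off_card; [|right|left].
have rI : 0 < #|ind_set S X| by rewrite ind_card off_card //; left.
have offv p : {in map val (p : seq {v : T | v \in S}), forall y, y \notin s}.
  by move=> y /mapP[v _ ->]; have := valP v; rewrite inE.
have dRI v : deg (@ind_rel T e S) v = dR (val v) by rewrite ind_deg.
have [[D cD szD]|[y [q [[pq uq sy sl nc] yl]]]] := ucycle_or_saturated bI off_connected cI rI; last first.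
  have q0 : 0 < size q by case: (q) yl => //; rewrite eqxx.
  have pv : path e (val y) (map val q) by rewrite -ind_path.
  have uv : uniq (val y :: map val q) by rewrite -[_ :: _]/(map val (y :: q)) (map_inj_uniq val_inj).
  have lv : last (val y) (map val q) = val (last y q) by rewrite last_map.
  have hC : dC (val y) + dC (val (last y q)) <= c.
    rewrite -lv; apply: detour_sum_le => //; last by rewrite size_map.
    exact: (offv (y :: q)).
  have hR Y : bigraph (@ind_rel T e S) Y -> #|~: Y| = r -> y \notin Y -> last y q \in Y ->
      dR (val y) + dR (val (last y q)) <= r.
    move=> bY cY yY lY; rewrite -!dRI (deg_count uq sy) (deg_count uq sl).
    have := noncross_count bY pq yY lY nc.
    have -> : count (ind_rel e (last y q)) (y :: q) = count (ind_rel e (last y q)) (belast y q).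
      by rewrite lastI -cats1 count_cat /= (bg_irr bY) !addn0.
    rewrite [count _ (y :: q)]/= (bg_irr bY) add0n addnC => h.
    apply: leq_trans h _; rewrite -cY -size_filter.
    have uf : uniq [seq z <- belast y q | [predC Y] z].
      by apply: filter_uniq; move: uq; rewrite lastI rcons_uniq => /andP[].
    rewrite -(card_uniqP uf); apply: subset_leq_card; apply/subsetP => z.
    by rewrite mem_filter !inE => /andP[].
  have {}hR : dR (val y) + dR (val (last y q)) <= r.
    have [yX|yX] := boolP (y \in ind_set S X).
      apply: (hR _ (bigraphC bI)).
      - by rewrite setCK ind_card off_card //; left.
      - by rewrite in_setC negbK.
      - by rewrite in_setC; move: yl; rewrite yX; case: (last y q \in _).
    apply: (hR _ bI) => //; first by rewrite ind_cardC off_card //; right.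
    by move: yl; rewrite (negbTE yX); case: (last y q \in ind_set S X).
  have yS : val y \notin s by have := valP y; rewrite inE.
  have lS : val (last y q) \notin s by have := valP (last y q); rewrite inE.
  have : c + r < deg e (val y) + deg e (val (last y q)).
    move: yl; rewrite !inE; have [yX lX|yX lX] := boolP (val y \in X).
      have lX' : val (last y q) \notin X by move: lX; case: (_ \in X).
      by apply: leq_ltn_trans (heavy yX lX' yS lS); rewrite leq_addr.
    have lX' : val (last y q) \in X by move: lX; case: (_ \in X).
    by rewrite [leqRHS]addnC; apply: leq_ltn_trans (heavy lX' yX lS yS); rewrite leq_addr.
  rewrite !deg_split; move: hC hR; clear; lia.
have cD' : ucycle e (map val D) by rewrite -ind_ucycle.
have szD' : size (map val D) = r.*2.
  rewrite size_map szD card_sig -addnn -{1}(off_card (or_introl erefl)) -(off_card (or_intror erefl)).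
  rewrite -(cardsID X S); congr addn; first by rewrite setIC.
  by rewrite setDE setIC.
have offD := offv D.
move: {D cD szD offv}(map val D) cD' szD' offD => D cD szD offD.
(* If both ends were attached, the rest of the cycle would be a detour on 2r vertices; if neither
   were, the degree sum would be at most 2r. *)
have both x w : ucycle e (x :: w) -> size (x :: w) = r.*2 -> {in x :: w, forall y, y \notin s} ->
   [/\ e (last x w) x, c + 2 <= dC x + dC (last x w) + r & (dC x == 0) (+) (dC (last x w) == 0)].
  move=> cw sw offw; have [cyc uw] := andP cw.
  have elx : e (last x w) x by move: cyc; rewrite /= rcons_path => /andP[].
  have pw : path e x w by move: cyc; rewrite /= rcons_path => /andP[].
  have hx : x \notin s by apply: offw; rewrite mem_head.
  have hl : last x w \notin s by apply: offw; rewrite mem_last.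
  have w0 : 0 < size w by move: sw r0 => /=; clear; lia.
  have sum : c + 2 <= dC x + dC (last x w) + r.
    have := heavy_adj elx hl hx; rewrite !deg_split.
    by have := dR_le x; have := dR_le (last x w); clear; lia.
  split=> //; have [a0|a0] := posnP (dC x); have [a1|a1] := posnP (dC (last x w)) => //.
    by move: sum rc; rewrite a0 a1; clear; lia.
  have := detour_sum pw uw offw w0 a0 a1; move: sum sw rc => /=; clear; lia.
have [y0 [w [cw sw offw y00]]] : exists y0 w, [/\ ucycle e (y0 :: w), size (y0 :: w) = r.*2,
    {in y0 :: w, forall y, y \notin s} & dC y0 = 0].
  case: D cD szD offD => [|x w] cD szD offD; first by move: szD r0 => /=; clear; lia.
  have [elx _ alt] := both x w cD szD offD.
  have [x0|x0] := posnP (dC x); first by exists x, w.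
  have l0 : dC (last x w) = 0 by move: alt; rewrite eqn0Ngt x0 /= => /eqP.
  case/lastP: w cD szD offD {alt elx} l0 => [|w v] cD szD offD.
    by rewrite /= => E; rewrite E in x0.
  rewrite last_rcons => v0; exists v, (x :: w); split=> //.
  - by rewrite -(rot_ucycle 1) rot1_cons.
  - by rewrite -szD /= size_rcons.
  - by move=> y; rewrite inE => yw; apply: offD; rewrite inE mem_rcons inE orbCA.
have [elx sum _] := both y0 w cw sw offw.
case: w cw sw offw elx sum => [|x1 w] cw sw offw elx sum.
  by move: sw r0 => /=; clear; lia.
have cw1 : ucycle e (x1 :: rcons w y0) by rewrite -rcons_cons -rot1_cons rot_ucycle.
have sw1 : size (x1 :: rcons w y0) = r.*2 by rewrite -sw /= size_rcons.
have off1 : {in x1 :: rcons w y0, forall y, y \notin s}.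
  by move=> y; rewrite inE mem_rcons inE orbCA => yw; apply: offw; rewrite !inE.
have [_ sum1 _] := both x1 (rcons w y0) cw1 sw1 off1.
rewrite last_rcons y00 in sum1; rewrite y00 [last _ _]/= in sum.
(* Here r = 1 and the cycle of the complement is a single edge; [x1] would need c + 1
   attachments. *)
have [w0|w0] := posnP (size w).
  by move: sw sum1 (dC_le x1) rc => /=; rewrite w0; clear; lia.
have [cyc uw] := andP cw.
have pw : path e x1 w by move: cyc; rewrite /= rcons_path => /and3P[].
have uw1 : uniq (x1 :: w) by move: uw; rewrite cons_uniq => /andP[].
have off2 : {in x1 :: w, forall y, y \notin s}.
  by move=> y yw; apply: offw; rewrite inE yw orbT.
have a0 : 0 < dC x1 by move: sum1 rc; clear; lia.
have a1 : 0 < dC (last x1 w).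
  by move: (dC (last x1 w)) sum rc; clear => d; lia.
have := detour_sum pw uw1 off2 w0 a0 a1.
have {}sw : (size w).+2 = r.*2 by [].
move: sw sum sum1 rc.
move: (dC x1) (dC (last x1 w)) (size w); clear => a b k *; lia.
Qed.

End RemovablePair.

(** * Edge counts under deletion of vertices and under covers *)

Section EdgeCounts.
Variables (T : finType) (e : rel T) (X : {set T}).
Hypothesis bigr : bigraph e X.

Lemma edges_in_le_prod (S : {set T}) : #|edges_in e X S| <= #|X :&: S| * #|~: X :&: S|.
Proof.
rewrite -cardsX; apply: subset_leq_card; apply/subsetP => -[a b].
by rewrite !inE /= => /and4P[aX aS bS /(bg_col bigr)]; rewrite aX aS bS => <-.
Qed.

Lemma nedges_remove_pair x y : x \in X -> y \notin X ->
  nedges e X + e x y <= #|edges_in e X (~: [set x; y])| + (deg e x + deg e y).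
Proof.
move=> xX yX.
pose Ax := [set (x, z) | z in nb e x]; pose By := [set (z, y) | z in nb e y].
have cA : #|Ax| = deg e x by apply: card_imset => u v [].
have cB : #|By| = deg e y by apply: card_imset => u v [].
rewrite -cA -cB -cardsUI addnA; apply: leq_add.
  apply: leq_trans (leq_card_setU _ _).
  apply: subset_leq_card; apply/subsetP => -[a b]; rewrite !inE /= => /andP[aX eab].
  have [ax|ax] := eqVneq a x.
    by apply/orP; right; apply/orP; left; apply/imsetP; exists b; rewrite ?inE -ax.
  have [bY|bY] := eqVneq b y.
    apply/orP; right; apply/orP; right; apply/imsetP; exists a; last by rewrite bY.
    by rewrite inE (bg_sym bigr) -bY.
  apply/orP; left; rewrite aX eab andbT /= !negb_or ?ax ?bY /= andbT.
  apply/andP; split; first by apply: contraNneq yX => <-.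
  have := bg_col bigr eab; rewrite aX => /esym bX.
  by apply: contraNneq bX => ->.
case exy: (e x y) => //=; rewrite card_gt0; apply/set0Pn; exists (x, y).
rewrite inE; apply/andP; split; apply/imsetP.
  by exists y; rewrite ?inE.
by exists x; rewrite ?inE // (bg_sym bigr).
Qed.

Lemma nedges_remove_vertex v :
  nedges e X <= #|edges_in e X (~: [set v])| + deg e v.
Proof.
have sw u : #|[set (u, z) | z in nb e v]| <= deg e v by apply: leq_imset_card.
have sw' u : #|[set (z, u) | z in nb e v]| <= deg e v by apply: leq_imset_card.
pose F := if v \in X then [set (v, z) | z in nb e v] else [set (z, v) | z in nb e v].
have cF : #|F| <= deg e v by rewrite /F; case: ifP.
apply: leq_trans (leq_add (leqnn _) cF); apply: leq_trans (leq_card_setU _ _).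
apply: subset_leq_card; apply/subsetP => -[a b]; rewrite !inE /= => /andP[aX eab].
have bX : b \notin X by have := bg_col bigr eab; rewrite aX => /esym.
rewrite aX eab andbT /= /F; have [vX|vX] := boolP (v \in X).
  have [E|av] := eqVneq a v.
    by apply/orP; right; apply/imsetP; exists b; rewrite ?inE -E.
  by rewrite (_ : b != v) //; apply: contraNneq bX => ->.
have [E|bv] := eqVneq b v.
  apply/orP; right; apply/imsetP; exists a; last by rewrite E.
  by rewrite inE (bg_sym bigr) -E.
by rewrite (_ : a != v) //; apply: contraNneq vX => <-.
Qed.

Lemma nedges_cover (S1 S2 : {set T}) : (forall u v, e u v -> (u \in S1) && (v \in S1) || (u \in S2) && (v \in S2)) ->
  nedges e X <= #|edges_in e X S1| + #|edges_in e X S2|.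
Proof.
move=> cov; apply: leq_trans (leq_card_setU _ _).
apply: subset_leq_card; apply/subsetP => -[a b]; rewrite !inE /= => /andP[aX eab].
by rewrite aX eab !andbT; exact: cov.
Qed.

End EdgeCounts.

Lemma longest_ucycle (T : finType) (e : rel T) s0 : ucycle e s0 ->
  exists2 s, ucycle e s & size s0 <= size s /\ forall s', ucycle e s' -> size s' <= size s.
Proof.
move=> c0.
have [s cs mx] := @longest_seq T (fun s => ucycleb e s) s0 (fun s => @ucycle_uniq _ e s) c0.
by exists s => //; split=> //; exact: mx.
Qed.

(** In the inductive step the classes have m + 1 vertices. The deleted pair costs at most m + 1
    edges, exactly the drop from (m + 1)(m + 2) / 2 to m (m + 1) / 2, and it avoids the longest
    cycle. The lower bound on [size s0] yields [r <= c]. *)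
Lemma long_cycle_pancyclic (T : finType) (e : rel T) (X : {set T}) m s0 l :
  bigraph e X -> #|X| = m -> #|~: X| = m -> m * m.+1 < (nedges e X).*2 ->
  ucycle e s0 -> m <= size s0 -> 1 < l -> l.*2 <= size s0 ->
  exists2 s, ucycle e s & size s = l.*2.
Proof.
elim: m T e X s0 => [|m IH] T e X s0 bigr cX cY dense c0 ms l1 ls.
  move: dense; rewrite (nedges_sum e X) (cards0_eq cX) big_set0 //.
have [s cs [s0s mx]] := longest_ucycle c0.
have [c sc] : exists c, size s = c.*2.
  by exists (count [in X] s); apply: (cycle_size bigr (ucycle_cycle cs)).
have us : uniq s by case/andP: cs.
have cnt (Y : {set T}) : bigraph e Y -> c = #|[set z in s] :&: Y|.
  move=> bY; rewrite card_count //; apply: double_inj.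
  by rewrite -sc (cycle_size bY (ucycle_cycle cs)).
have cm : c <= m.+1.
  by rewrite (cnt X bigr) -cX; apply: subset_leq_card; apply: subsetIr.
have lc : 1 < l <= c by rewrite l1 -leq_double -sc (leq_trans ls).
have [cE|cNE] := eqVneq c m.+1.
  apply: (dense_hamiltonian_pancyclic bigr cs sc) lc; last by rewrite cE.
  have full (Y : {set T}) : bigraph e Y -> #|Y| = m.+1 -> Y \subset [set z in s].
    move=> bY cYm; have := subset_leqif_card (subsetIr [set z in s] Y).
    rewrite -(cnt Y bY) cYm cE => /leqif_refl/subsetP sub.
    by apply/subsetP => z /sub/setIP[].
  move=> v; have [vX|vX] := boolP (v \in X).
    by have := subsetP (full X bigr cX) v vX; rewrite inE.
  have vX' : v \in ~: X by rewrite inE.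
  by have := subsetP (full _ (bigraphC bigr) cY) v vX'; rewrite inE.
pose r := m.+1 - c.
have Er : m.+1 = c + r by rewrite /r subnKC.
have r0 : 0 < r by move: cNE cm; rewrite /r; clear; lia.
have rc : r <= c.
  by move: (leq_trans ms s0s); rewrite sc Er; clear; lia.
have [x [y [xX yX xs ys light]]] : exists x y, [/\ x \in X, y \notin X, x \notin s, y \notin s
    & deg e x + deg e y <= m.+1 + e x y].
  have [|/existsPn H] := boolP [exists x, exists y, [&& x \in X, y \notin X, x \notin s, y \notin s
      & deg e x + deg e y <= m.+1 + e x y]].
    by case/existsP=> x /existsP[y /and5P[? ? ? ? ?]]; exists x, y.
  exfalso; apply: (heavy_pairs_absurd bigr cs mx sc (r := r)); rewrite -?Er //.
  move=> x y xX yX xs ys; rewrite ltnNge; apply/negP => light.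
  by have := H x; rewrite negb_exists => /forallP/(_ y); rewrite xX yX xs ys light.
pose S := ~: [set x; y].
have bI := ind_bigraph S bigr.
have cI (Y : {set T}) z : (z \in Y) -> (forall w, w \in [set x; y] -> (w \in Y) = (w == z)) -> #|Y| = m.+1 -> z \in [set x; y] -> #|Y :&: S| = m.
  move=> zY H cYm zxy; have : #|Y :\ z| = m by move: cYm; rewrite (cardsD1 z) zY add1n => -[].
  move=> <-; apply: eq_card => w; rewrite in_setI in_setC in_setD1.
  have [wxy|wxy] := boolP (w \in [set x; y]); first by rewrite (H w wxy); case: eqP.
  by rewrite /= andbT (_ : w != z) //; apply: contraNneq wxy => ->.
have xy : x != y by apply: contraTneq xX => ->.
have c1 : #|ind_set S X| = m.
  rewrite ind_card; apply: (cI X x) => //; last by rewrite !inE eqxx.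
  by move=> w; rewrite !inE => /orP[/eqP->|/eqP->]; rewrite ?xX ?eqxx // (negbTE yX) eq_sym (negbTE xy).
have c2 : #|~: ind_set S X| = m.
  rewrite ind_cardC; apply: (cI (~: X) y) => //; rewrite ?inE ?yX ?eqxx ?orbT //.
  by move=> w; rewrite !inE => /orP[/eqP->|/eqP->]; rewrite ?xX ?yX ?eqxx // (negbTE xy).
have [s1 Es1] : exists s1 : seq {v : T | v \in S}, map val s1 = s.
  by apply: ind_lift => z zs; rewrite !inE negb_or; apply/andP; split; apply: contraTneq zs => ->.
have cs1 : ucycle (@ind_rel T e S) s1 by rewrite ind_ucycle Es1.
have ss1 : size s1 = size s by rewrite -Es1 size_map.
have d1 : m * m.+1 < (nedges (@ind_rel T e S) (ind_set S X)).*2.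
  rewrite ind_nedges; have := nedges_remove_pair bigr xX yX; rewrite -/S.
  by move: dense light; clear; move: #|_| (nedges e X) (deg e x) (deg e y) (nat_of_bool _); nia.
have h1 : m <= size s1 by rewrite ss1; apply: leq_trans s0s; apply: ltnW.
have h2 : l.*2 <= size s1 by rewrite ss1; apply: leq_trans s0s.
have [s2 cs2 ss2] := IH _ _ _ s1 bI c1 c2 d1 cs1 h1 l1 h2.
by exists (map val s2); [rewrite -ind_ucycle | rewrite size_map].
Qed.

(** On at most two vertices [two_connected] is vacuous. Otherwise a vertex of [V] is deleted or, if
    [V] is a singleton, one outside it. *)
Lemma two_connected_connected (T : finType) (e : rel T) :
  2 < #|T| -> two_connected e -> connected_graph e.
Proof.
move=> T3 conn2 V V0 VT.
have /set0Pn[v vV] := V0.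
have [E|V1] := eqVneq (V :\ v) set0; last first.
  have [||a [b [aV bV bv eab]]] := conn2 v (V :\ v) _ V1; first by rewrite !inE eqxx.
    have /set0Pn[b] : ~: V != set0.
      by apply: contraNneq VT => E; rewrite -[V]setCK E setC0.
    rewrite inE => bV; exists b; first by rewrite !inE negb_and bV orbT.
    by apply: contraNneq bV => ->.
  exists a, b; split=> //; first by move: aV; rewrite inE => /andP[].
  by move: bV; rewrite !inE bv.
have VE : V = [set v] by apply/eqP; rewrite eqEsubset -setD_eq0 E eqxx sub1set.
have /card_gt1P[w [w' [wV w'V ww']]] : 1 < #|~: V|.
  by have := cardsC V; rewrite VE cards1; move: T3; clear; lia.
have [||a [b [aV bV bv eab]]] := conn2 w V _ V0.
- by move: wV; rewrite inE.
- by exists w'; [move: w'V; rewrite inE | rewrite eq_sym].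
by exists a, b.
Qed.

Lemma two_connected_long_cycle (T : finType) (e : rel T) (X : {set T}) m t :
  bigraph e X -> two_connected e -> #|X| = m -> #|~: X| = m -> 1 < m -> t <= m ->
  (forall x y, x \in X -> y \notin X -> t < deg e x + deg e y) ->
  exists2 s, ucycle e s & t.*2 <= size s.
Proof.
move=> bigr conn2 cX cY m1 tm H.
have cT : #|T| = m.*2 by rewrite -(cardsC X) cX cY addnn.
have conn : connected_graph e.
  by apply: two_connected_connected => //; rewrite cT; move: m1; clear; lia.
have cXY : #|X| = #|~: X| by rewrite cX cY.
have X0 : 0 < #|X| by rewrite cX ltnW.
have [[s cs ss]|[y [q [sat yl]]]] := ucycle_or_saturated bigr conn cXY X0.
  by exists s => //; rewrite ss cT leq_double.
have fin (s : seq T) a b : t < a + b -> (a + b).*2 <= (size s).+2 -> t.*2 <= size s.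
  by clear; lia.
have [yX|yX] := boolP (y \in X).
  have lX : last y q \notin X by move: yl; rewrite yX; case: (_ \in X).
  have [||s cs ss] := saturated_ucycle (bigraphC bigr) conn2 sat; rewrite ?inE ?negbK //.
  by exists s => //; apply: fin ss; exact: H.
have lX : last y q \in X by move: yl; rewrite (negbTE yX); case: (_ \in X).
have [s cs ss] := saturated_ucycle bigr conn2 sat yX lX.
by exists s => //; apply: fin ss; rewrite addnC; exact: H.
Qed.

(** * Minimal counterexamples *)

(** The right side exceeds the left by (max - 1)(c - min). *)
Lemma product_bound a b c : minn a b <= c -> 0 < maxn a b ->
  a * b + c <= maxn a b * c + minn a b.
Proof. by case: (leqP a b) => ab; nia. Qed.

(* On the square [u, w <= c] the product bounds give a bilinear estimate, which
   is linear in [w] for fixed [u]; outside it the linear bounds suffice. *)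
Lemma crossed_lobes m c u w I J E1 E2 :
  I + w = m.+1 -> u + J = m -> 0 < w -> 0 < I -> c < m <= c.*2 ->
  E1 <= I * u -> E1 + c <= I * c + u -> E2 <= w * J -> E2 + c <= J * c + w ->
  E1 + E2 + c <= m * c + m.
Proof.
move=> hI hJ w0 I0 /andP[cm mc] b1 l1 b2 l2.
have [uc|uc] := leqP u c; last first.
  have [w' hw] : exists w', w = w'.+1 by exists w.-1; lia.
  have Jc : w' * J <= w' * c by rewrite leq_mul2l; apply/orP; right; lia.
  have E : m * c = I * c + w' * c by rewrite -mulnDl; congr muln; lia.
  suff : u + w * J <= w' * c + m by lia.
  by rewrite hw mulSn; lia.
have [wc|wc] := leqP w c; last first.
  have Iu : I * u <= c * u by rewrite leq_mul2r; apply/orP; right; lia.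
  have E : m * c = c * u + J * c by rewrite -hJ; lia.
  lia.
(* Over the integers this is (w - 1)(J - u) + (c - u) <= m (c - u). The existentials below name the
   differences, to avoid truncated subtraction. *)
suff : I * u + w * J + c <= m * c + m by lia.
have [w' hw] : exists w', w = w'.+1 by exists w.-1; lia.
have {hI}hI : I + w' = m by lia.
have E : I * u + w' * u = m * u by rewrite -mulnDl hI.
have [d3 hd3] : exists d, c = u + d by exists (c - u); lia.
have Ec : m * c = m * u + m * d3 by rewrite hd3 mulnDr.
have [um|um] := leqP u.*2 m.
  have [d2 hd2] : exists d, J = u + d by exists (J - u); lia.
  have EJ : w * J = w' * u + w' * d2 + J by rewrite hw mulSn hd2 mulnDr; lia.
  suff : w' * d2 + d3 <= m * d3 by lia.
  have wd : w' * d2 + d2 <= (u + d3) * d2 by rewrite -mulSnr leq_mul2r; apply/orP; right; lia.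
  have Em : m * d3 = u * d3 + u * d3 + d2 * d3 by rewrite -hJ hd2 !mulnDl; lia.
  (* [d4] is 2c - m, so this is where m <= 2c enters. *)
  have [d4 hd4] : exists d, d3 + d3 = d2 + d by exists (d3 + d3 - d2); lia.
  have E4 : u * d3 + u * d3 = u * d2 + u * d4 by rewrite -!mulnDr hd4.
  rewrite mulnDl in wd; suff : d3 <= u * d4 + d2 by lia.
  by case: (posnP u) => u0; [lia | have := leq_mul u0 (leqnn d4); lia].
have [d5 hd5] : exists d, u = J + d by exists (u - J); lia.
have EJ : w * J + w' * d5 = w' * u + J by rewrite hw mulSn hd5 mulnDr; lia.
have m0 : d3 <= m * d3 by rewrite leq_pmull //; lia.
lia.
Qed.

(** The cut vertex is counted in both lobes, hence [m.+1]. If the same class dominates both lobes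
    the linear bounds add up; otherwise the lobes are crossed. *)
Lemma lobes_bound m c I I' J J' E1 E2 :
  I + I' = m.+1 -> J + J' = m -> 0 < I -> 0 < I' -> 0 < c -> c < m <= c.*2 ->
  E1 <= I * J -> E1 + c <= maxn I J * c + minn I J ->
  E2 <= I' * J' -> E2 + c <= maxn I' J' * c + minn I' J' ->
  E1 + E2 + c <= m * c + m.
Proof.
move=> hI hJ I0 I0' c0 cm b1 l1 b2 l2.
move: l1 l2; case: (leqP I J) => h1; case: (leqP I' J') => h2 l1 l2.
- have -> : m * c + m = (J + J') * c + (I + I').-1 by rewrite hJ hI.
  nia.
- by rewrite [E1 + E2]addnC; apply: (@crossed_lobes m c J' I I' J E2 E1) => //; rewrite addnC.
- exact: (@crossed_lobes m c J I' I J' E1 E2).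
- nia.
Qed.

Lemma subgraph_cycle (T : finType) (e : rel T) (S : {set T}) k :
  (exists2 s, ucycle (@ind_rel T e S) s & size s = k) -> exists2 s, ucycle e s & size s = k.
Proof.
by case=> s cs ss; exists (map val s); [rewrite -ind_ucycle | rewrite size_map].
Qed.

(* [c] is the paper's [m - k - 1]. *)
Section Sparse.
Variables (T : finType) (e : rel T) (X : {set T}) (c : nat).
Hypothesis bigr : bigraph e X.
Hypothesis c0 : 0 < c.
Hypothesis sparse : forall S : {set T}, S != [set: T] -> S != set0 ->
  #|edges_in e X S| + c <= maxn #|X :&: S| #|~: X :&: S| * c + minn #|X :&: S| #|~: X :&: S|.

(** Deleting a vertex of the larger class lowers the bound by c, so in a dense graph all these
    degrees exceed c. Then the edges that avoid one such vertex number at least (|X| - 1)(c + 1),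
    too many for the subgraph left by its deletion. *)
Lemma unbalanced_sparse : #|~: X| < #|X| -> c < #|~: X| ->
  nedges e X + c <= #|X| * c + #|~: X|.
Proof.
move=> ba cb; rewrite leqNgt; apply/negP => dense.
have cut v : v \in X -> #|edges_in e X (~: [set v])| + c <= #|X|.-1 * c + #|~: X|.
  move=> vX; have cXv : #|X :&: ~: [set v]| = #|X|.-1.
    by rewrite (cardsD1 v X) vX /=; apply: eq_card => z; rewrite !inE andbC.
  have cYv : #|~: X :&: ~: [set v]| = #|~: X|.
    apply: eq_card => z; rewrite !inE; case: eqP => [->|]; rewrite ?vX ?andbT //.
  have := sparse (S := ~: [set v]); rewrite cXv cYv.
  have -> : maxn #|X|.-1 #|~: X| = #|X|.-1 by move: ba; clear; lia.
  have -> : minn #|X|.-1 #|~: X| = #|~: X| by move: ba; clear; lia.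
  apply.
    by rewrite -(setC0) (inj_eq (can_inj (@setCK T))); apply/set0Pn; exists v; rewrite inE.
  by rewrite -card_gt0 -(cardsID X) setIC cXv; move: ba cb; clear; lia.
have big v : v \in X -> c < deg e v.
  move=> vX; have := nedges_remove_vertex bigr v; have := cut v vX; move: dense.
  have -> : #|X| * c = #|X|.-1 * c + c.
    by rewrite -mulSnr prednK //; move: ba; clear; lia.
  by clear; lia.
have [v vX] : exists v, v \in X by apply/card_gt0P; move: ba; clear; lia.
have : deg e v + #|X|.-1 * c.+1 <= nedges e X.
  rewrite (nedges_sum e) (bigD1 v) //= leq_add2l.
  have -> : #|X|.-1 = #|[pred i in X | i != v]|.
    by rewrite (cardsD1 v X) vX /=; apply: eq_card => z; rewrite !inE andbC.
  by rewrite -sum_nat_const; apply: leq_sum => i /andP[iX _]; exact: big.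
have := nedges_remove_vertex bigr v; have := cut v vX.
by rewrite mulnS; move: ba c0; clear; lia.
Qed.

Variable m : nat.
Hypothesis cX : #|X| = m.
Hypothesis cY : #|~: X| = m.
Hypothesis cm : c < m <= c.*2.
Hypothesis dense : m * c + m < nedges e X + c.

(** Deleting one vertex from each class lowers the bound by c + 1, so more edges than that must
    disappear. *)
Lemma sparse_degrees x y : x \in X -> y \notin X -> c.+1 < deg e x + deg e y.
Proof.
move=> xX yX; pose S := ~: [set x; y].
have c1 : #|X :&: S| = m.-1.
  rewrite -cX (cardsD1 x X) xX /=; apply: eq_card => z; rewrite !inE andbC.
  by rewrite negb_or; have [->|_] := eqVneq z y; rewrite ?andbF ?(negbTE yX) ?andbT ?andbF.
have c2 : #|~: X :&: S| = m.-1.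
  rewrite -cY (cardsD1 y (~: X)) inE yX /=; apply: eq_card => z; rewrite !inE andbC.
  by rewrite negb_or; have [->|_] := eqVneq z x; rewrite ?xX ?andbF.
have := sparse (S := S); rewrite c1 c2 maxnn minnn => sp.
have {}sp : #|edges_in e X S| + c <= m.-1 * c + m.-1.
  apply: sp.
    by rewrite -setC0 (inj_eq (can_inj (@setCK T))); apply/set0Pn; exists x; rewrite !inE eqxx.
  by rewrite -card_gt0 -(cardsID X) setIC c1; move: cm c0; clear; lia.
have := nedges_remove_pair bigr xX yX; move: sp dense; rewrite -/S.
have -> : m * c = m.-1 * c + c by rewrite -mulSnr prednK //; move: cm; clear; lia.
by move: cm; clear; lia.
Qed.

Lemma sparse_two_connected : two_connected e.
Proof.
move=> v V vV V0 [b0 b0V b0v].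
have [|/existsPn none] := boolP [exists a, exists b, [&& a \in V, b \notin V, b != v & e a b]].
  by case/existsP => a /existsP[b /and4P[? ? ? ?]]; exists a, b.
have {}none a b : a \in V -> b \notin V -> b != v -> e a b = false.
  move=> aV bV bv; apply/negbTE; have := none a; rewrite negb_exists => /forallP/(_ b).
  by rewrite aV bV bv.
exfalso; pose S1 := v |: V; pose S2 := ~: V.
have cov : nedges e X <= #|edges_in e X S1| + #|edges_in e X S2|.
  apply: nedges_cover => u w euw; rewrite !inE.
  have [uV|uV] := boolP (u \in V); have [wV|wV] := boolP (w \in V).
  - by rewrite !orbT.
  - have [_|wv] := eqVneq w v; first by rewrite !orbT.
    by rewrite none in euw.
  - have [_|uv] := eqVneq u v; first by rewrite orbT.
    by rewrite (bg_sym bigr) none in euw.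
  - by rewrite orbT.
have S1T : S1 != [set: T].
  by apply: contraNneq b0V => E; have := in_setT b0; rewrite -E !inE (negbTE b0v).
have S2T : S2 != [set: T] by rewrite -setC0 (inj_eq (can_inj (@setCK T))).
have S10 : S1 != set0 by apply/set0Pn; exists v; rewrite !inE eqxx.
have S20 : S2 != set0 by apply/set0Pn; exists v; rewrite !inE.
have sizes (Y : {set T}) : #|Y| = m -> #|Y :&: S1| + #|Y :&: S2| = m + (v \in Y).
  move=> <-; rewrite -(cardsID V Y) (cardsD1 v (Y :&: S1)) !inE eqxx andbT -addnA addnC.
  congr (_ + _ + _); last by rewrite setDE.
  apply: eq_card => z; rewrite !inE; have [->|_] //= := eqVneq z v.
  by rewrite (negbTE vV) andbF.
have := sparse S1T S10; have := sparse S2T S20.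
have := edges_in_le_prod bigr S1; have := edges_in_le_prod bigr S2.
have := sizes X cX; have := sizes (~: X) cY; rewrite inE.
have v1 (Y : {set T}) : v \in Y -> 0 < #|Y :&: S1|.
  by move=> vY; apply/card_gt0P; exists v; rewrite !inE vY eqxx.
have v2 (Y : {set T}) : v \in Y -> 0 < #|Y :&: S2|.
  by move=> vY; apply/card_gt0P; exists v; rewrite !inE vY.
have [vX|vX] := boolP (v \in X); rewrite ?addn0 ?addn1.
  move=> e2 e1 b2 b1 l2 l1.
  have := lobes_bound e1 e2 (v1 X vX) (v2 X vX) c0 cm b1 l1 b2 l2.
  by move: cov dense; clear; lia.
(* The class of the cut vertex is the one with total m + 1, so here the classes exchange their roles
   in [lobes_bound]. *)
have vX' : v \in ~: X by rewrite inE.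
move=> e2 e1; rewrite ![#|X :&: _| * _]mulnC ![maxn #|X :&: _| _]maxnC ![minn #|X :&: _| _]minnC.
move=> b2 b1 l2 l1.
have := lobes_bound e2 e1 (v1 _ vX') (v2 _ vX') c0 cm b1 l1 b2 l2.
by move: cov dense; clear; lia.
Qed.

Lemma sparse_pancyclic l : 1 < l <= c.+1 -> exists2 s, ucycle e s & size s = l.*2.
Proof.
move=> /andP[l1 lc].
have m1 : 1 < m by move: cm c0; clear; lia.
have ctm : c.+1 <= m by case/andP: cm.
have [s cs ss] := two_connected_long_cycle bigr sparse_two_connected cX cY m1 ctm sparse_degrees.
apply: (long_cycle_pancyclic bigr cX cY _ cs) => //.
(* Doubling the bound gives 2c(m - 1) + 2m, which is at least m (m + 1) because m <= 2c. *)
- have [k mk] : exists k, m = k.+1 by exists m.-1; rewrite prednK // ltnW.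
  have : k.+1 * k <= c.*2 * k by rewrite leq_mul2r -mk; case/andP: cm => _ ->; rewrite orbT.
  by move: dense; rewrite mk mulSn -addnn mulnDl !mulSn !mulnS [c * k]mulnC; clear; lia.
- by apply: leq_trans ss; move: cm; clear; lia.
- by apply: leq_trans ss; rewrite leq_double.
Qed.

End Sparse.

Lemma dense_bipartite_pancyclic (T : finType) (e : rel T) (X : {set T}) c l :
  bigraph e X -> 0 < c -> c < #|X| -> c < #|~: X| -> minn #|X| #|~: X| <= c.*2 ->
  maxn #|X| #|~: X| * c + minn #|X| #|~: X| < nedges e X + c -> 1 < l <= c.+1 ->
  exists2 s, ucycle e s & size s = l.*2.
Proof.
move: {2}#|T| (leqnn #|T|) => N.
elim: N T e X => [|N IH] T e X leT bigr c0 cX cY small dense lb.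
  by have := leq_trans cX (leq_trans (max_card _) leT); rewrite ltn0.
have [/existsP[S /and4P[ST aS bS dS]]|/existsPn none] := boolP [exists S : {set T},
  [&& S != setT, c < #|X :&: S|, c < #|~: X :&: S| &
   maxn #|X :&: S| #|~: X :&: S| * c + minn #|X :&: S| #|~: X :&: S| < #|edges_in e X S| + c]].
  apply: (@subgraph_cycle _ _ S); apply: (IH _ _ (ind_set S X)) => //.
  - rewrite card_sig -ltnS; apply: leq_trans leT; rewrite -cardsT.
    by apply: proper_card; rewrite properEneq ST subsetT.
  - exact: ind_bigraph.
  - by rewrite ind_card.
  - by rewrite ind_cardC.
  - rewrite ind_card ind_cardC; have := subset_leq_card (subsetIl X S).
    by have := subset_leq_card (subsetIl (~: X) S); move: small; clear; lia.
  - by rewrite ind_card ind_cardC ind_nedges.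
(* Subsets with more than c vertices in both classes are covered by minimality, the remaining ones
   by [product_bound]. *)
have sparse (S : {set T}) : S != [set: T] -> S != set0 ->
    #|edges_in e X S| + c <= maxn #|X :&: S| #|~: X :&: S| * c + minn #|X :&: S| #|~: X :&: S|.
  move=> ST S0; have := none S; rewrite ST /= !negb_and -!leqNgt.
  have big : 0 < maxn #|X :&: S| #|~: X :&: S|.
    rewrite -card_gt0 -(cardsID X) setDE ![S :&: _]setIC in S0.
    by move: S0; clear; lia.
  have prod : minn #|X :&: S| #|~: X :&: S| <= c ->
      #|edges_in e X S| + c <= maxn #|X :&: S| #|~: X :&: S| * c + minn #|X :&: S| #|~: X :&: S|.
    move=> h; apply: leq_trans (product_bound h big); rewrite leq_add2r.
    exact: edges_in_le_prod.
  by case/or3P => // h; apply: prod; rewrite geq_min h ?orbT.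
have [lt|gt|cXY] := ltngtP #|X| #|~: X|.
- have sparseC (S : {set T}) : S != [set: T] -> S != set0 ->
      #|edges_in e (~: X) S| + c <= maxn #|~: X :&: S| #|~: ~: X :&: S| * c + minn #|~: X :&: S| #|~: ~: X :&: S|.
    move=> ST S0; rewrite setCK maxnC minnC; apply: leq_trans (sparse S ST S0).
    rewrite leq_add2r -!ind_nedges -(nedgesC (ind_bigraph S bigr)).
    rewrite /nedges; apply: subset_leq_card; apply/subsetP => p.
    by rewrite !inE.
  have := unbalanced_sparse (bigraphC bigr) c0 sparseC; rewrite setCK (nedgesC bigr).
  move=> /(_ lt cX); move: dense.
  rewrite (maxn_idPr (ltnW lt)) (minn_idPl (ltnW lt)).
  by clear; lia.
- have := unbalanced_sparse bigr c0 sparse gt cY; move: dense.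
  by rewrite (maxn_idPl (ltnW gt)) (minn_idPr (ltnW gt)); clear; lia.
move: small dense; rewrite -cXY maxnn minnn => small dense.
apply: (sparse_pancyclic bigr c0 sparse (m := #|X|)) => //.
by rewrite cX small.
Qed.

Lemma edges_le_nedges (T : finType) (e : rel T) (X : {set T}) :
  bigraph e X -> #|edges e| <= nedges e X.
Proof.
move=> bigr; rewrite /nedges; apply: leq_trans (leq_imset_card (fun p : T * T => [set p.1; p.2]) _).
apply: subset_leq_card; apply/subsetP => E /imsetP[[u v]]; rewrite inE /= => euv ->.
have [uX|uX] := boolP (u \in X).
  by apply/imsetP; exists (u, v); rewrite // inE /= uX.
apply/imsetP; exists (v, u); last by rewrite setUC.
rewrite inE /= (bg_sym bigr) euv andbT.
by have := bg_col bigr euv; rewrite (negbTE uX) => /esym/negbFE.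
Qed.

Unset Implicit Arguments.

Theorem theorem1p4 (T : finType) (e : rel T) (X Y : {set T}) (m n k : nat)
    (simple_e : simple_graph e) (bip : bipartition e X Y)
    (cardX : #|X| = m) (cardY : #|Y| = n)
    (le_mn : m <= n) (le_km : 2 * k + 2 <= m)
    (many_edges : n * (m - k - 1) + k + 2 <= #|edges e|) :
  forall l : nat, ~~ odd l -> 4 <= l <= 2 * m - 2 * k -> has_cycle e l.
Proof.
move=> l evenl /andP[l4 lm].
have [XY disXY eXY] := bip.
have EY : Y = ~: X.
  apply/setP => z; rewrite inE; have := in_setT z; rewrite -XY inE.
  by case: (boolP (z \in X)) => [zX _|_ /= ->//]; rewrite (disjointFr disXY zX).
have bigr : bigraph e X.
  split=> [|u v /eXY]; first by case: simple_e.
  by rewrite EY !inE; case: (u \in X); case: (v \in X).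
have [l' El] : exists l', l = l'.*2 by exists l./2; rewrite -{1}(odd_double_half l) (negbTE evenl).
rewrite EY in cardY.
have ne := leq_trans many_edges (edges_le_nedges bigr).
(* For c = m - k - 1 the constant k + 2 is m - c + 1, the hypothesis 2k + 2 <= m reads m <= 2c, and
   the top length 2m - 2k is 2(c + 1). *)
have [||||||s cs ss] := @dense_bipartite_pancyclic T e X (m - k - 1) l' bigr;
  rewrite ?cardX ?cardY ?(maxn_idPr le_mn) ?(minn_idPl le_mn).
- by clear -le_km; lia.
- by clear -le_km; lia.
- by clear -le_km le_mn; lia.
- by clear -le_km; lia.
- by move: ne; clear -le_km; lia.
- by clear -l4 lm El le_km; lia.
by exists s; rewrite ss -El; split=> //; apply: leq_trans l4.
Qed.
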